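(* Let $(\mathcal A,\phi)$ be a noncommutative probability space. Suppose that $a$ and $\{p,b\}$ in $\mathcal A$ are $*$-free, with $a$ $R$-diagonal and $p$ a projection with $\phi(p)=c$. In the reduced probability space $(p\mathcal Ap,\phi(p)^{-1}\phi)$, $\mu_{p(a+b)(a+b)^*p}$ is uniquely identified by $\mu_{paa^*p}$ and $\mu_{pbb^*p}$ through the equation $$\mu_{p(a+b)(a+b)^*p}\oslash\mu_c=\big(\mu_{paa^*p}\oslash\mu_c\big)\boxplus\big(\mu_{pbb^*p}\oslash\mu_c\big).$$ In particular, $\mu_{p(a+b)(a+b)^*p}$ has no dependence on mixed moments of $a$ and $b$.
   Context: A noncommutative probability space $(\mathcal A,\phi)$ is a unital $*$-algebra $\mathcal A$ with a linear functional $\phi$ normalized by $\phi(1)=1$. ''$a$ and $\{p,b\}$ are $*$-free'' means that the unital $*$-subalgebras generated by $a$ and by $\{p,b\}$ are free; no freeness between $p$ and $b$ is assumed. The constant $c=\phi(p)$ is nonzero, as is implicit in forming $\phi(p)^{-1}\phi$. The distribution $\mu_x$ of an element $x$ is given by its moments; all three distributions in the equation are computed in $(p\mathcal Ap,\phi(p)^{-1}\phi)$, i.e. the $k$-th moment of $\mu_{pxx^*p}$ is $c^{-1}\phi((pxx^*p)^k)$. The joint $R$-series $R_{\mu_{x_1,x_2}}(z_1,z_2)$ is the power series in noncommuting variables whose coefficients $\kappa$ (the joint free cumulants) are determined by $\phi(x_{i_1}\cdots x_{i_m})=\sum_{\pi\in NC(m)}\prod_{B\in\pi}\kappa_{(i_j)_{j\in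 B}}$, with $NC(m)$ the noncrossing partitions of $\{1,\dots,m\}$. An element $a$ is $R$-diagonal if $R_{\mu_{a,a^*}}(z_1,z_2)=\sum_{n\ge1}\alpha_n\big((z_1z_2)^n+(z_2z_1)^n\big)$ for some scalars $\alpha_n$. For a single moment sequence $(m_k)$, the free cumulants $(\kappa_k)$ are given by $m_k=\sum_{\pi\in NC(k)}\prod_{B\in\pi}\kappa_{|B|}$, and $R_\mu(z)=\sum_{k\ge1}\kappa_kz^k$. For $f=\sum_{k\ge1}f_kz^k$ and $g=\sum_{k\ge1}g_kz^k$ the boxed convolution $f\star g$ has $m$-th coefficient $\sum_{\pi\in NC(m)}\prod_{B\in\pi}f_{|B|}\prod_{C\in K(\pi)}g_{|C|}$, with $K(\pi)$ the Kreweras complement of $\pi$; its unit is $Id(z)=z$. Additive free convolution $\boxplus$ satisfies $R_{\mu\boxplus\nu}=R_\mu+R_\nu$, and multiplicative free deconvolution $\oslash$, viewed as an operation on moments, is given by $R_{\mu\oslash\nu}=R_\mu\star R_\nu^{-1}$ (inverse with respect to $\star$; equivalently $(\mu\oslash\nu)\boxtimes\nu=\mu$, with $\boxtimes$ multiplicative free convolution). $\mu_c$ is the Marchenko–Pastur law with parameter $c$, whose $k$-th free cumulant is $c^{k-1}$ for all $k\ge1$.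
   Formalization: The functional φ is additionally assumed to be a trace, φ(xy)=φ(yx); without this the displayed equation fails (e.g. p=1, a circular, b=E_12 in M_2 with the vector state at e_1, *-free from a). *)

(* Defs.v *)
From HB Require Import structures.
From mathcomp Require Import all_boot all_order all_algebra.

Set Implicit Arguments.
Unset Strict Implicit.
Unset Printing Implicit Defensive.

Import Order.TTheory GRing.Theory Num.Theory.

(** * Noncrossing partitions *)

Definition noncrossing (n : nat) (P : {set {set 'I_n}}) : bool :=
  [forall i : 'I_n, forall j : 'I_n, forall k : 'I_n, forall l : 'I_n,
    [&& i < j, j < k, k < l, pblock P i == pblock P k
      & pblock P j == pblock P l]%N ==> (pblock P i == pblock P j)].

Definition NC (n : nat) : {set {set {set 'I_n}}} :=
  [set P | partition P [set: 'I_n] && noncrossing P].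

Definition refines (n : nat) (P Q : {set {set 'I_n}}) : bool :=
  [forall B in P, exists D in Q, B \subset D].

Lemma interleave_bar_subproof (n : nat) (i : 'I_n) : (i.*2.+1 < n.*2)%N.
Proof. by rewrite ltn_Sdouble. Qed.

Lemma interleave_subproof (n : nat) (i : 'I_n) : (i.*2 < n.*2)%N.
Proof. by rewrite ltn_double. Qed.

(* In 0 < 0' < 1 < 1' < ... < n-1 < (n-1)', identified with 'I_(n.*2), the
   point i is sent to 2i and the point i' to 2i+1. *)
Definition pos (n : nat) (i : 'I_n) : 'I_(n.*2) :=
  Ordinal (interleave_subproof i).
Definition pos_bar (n : nat) (i : 'I_n) : 'I_(n.*2) :=
  Ordinal (interleave_bar_subproof i).

Definition interleave (n : nat) (P Q : {set {set 'I_n}}) :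
    {set {set 'I_(n.*2)}} :=
  [set [set pos i | i in B] | B : {set 'I_n} in P] :|:
  [set [set pos_bar i | i in B] | B : {set 'I_n} in Q].

(* Q is the largest noncrossing partition, in the refinement order, whose
   interleaving with P is noncrossing. *)
Definition is_kreweras (n : nat) (P Q : {set {set 'I_n}}) : bool :=
  [&& Q \in NC n, interleave P Q \in NC n.*2 &
    [forall Q' in NC n, (interleave P Q' \in NC n.*2) ==> refines Q' Q]].

(* The default value set0 is never used when P is in NC n. *)
Definition kreweras (n : nat) (P : {set {set 'I_n}}) : {set {set 'I_n}} :=
  odflt set0 [pick Q | is_kreweras P Q].

From mathcomp Require Import all_classical all_reals.
From mathcomp Require Import complex.

Local Open Scope classical_set_scope.
Local Open Scope ring_scope.

(** * Distributions and R-series in one variable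

   A distribution is given by its moments, and a power series without constant
   term by its coefficients; both are sequences nat -> C of which only the
   values at positive indices are meaningful. *)

Section Distributions.
Variable C : numClosedFieldType.
Implicit Types (f g mu nu : nat -> C).

Definition eq_pos f g : Prop := forall k : nat, (0 < k)%N -> f k = g k.

Definition moments_of_cumulants f : nat -> C :=
  fun m => \sum_(P in NC m) \prod_(B in P) f #|B|.

(* The R-series of mu. *)
Definition free_cumulants mu : nat -> C :=
  xget (fun=> 0) [set f | eq_pos mu (moments_of_cumulants f)].

Definition boxed_conv f g : nat -> C :=
  fun m => \sum_(P in NC m)
    (\prod_(B in P) f #|B|) * (\prod_(D in kreweras P) g #|D|).

Definition Id_series : nat -> C := fun k => (k == 1%N)%:R.

Definition boxed_inv f : nat -> C :=
  xget (fun=> 0) [set g | eq_pos (boxed_conv f g) Id_series /\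
                          eq_pos (boxed_conv g f) Id_series].

Definition free_add mu nu : nat -> C :=
  moments_of_cumulants (fun k => free_cumulants mu k + free_cumulants nu k).

Definition free_mul_deconv mu nu : nat -> C :=
  moments_of_cumulants
    (boxed_conv (free_cumulants mu) (boxed_inv (free_cumulants nu))).

Definition marchenko_pastur (c : C) : nat -> C :=
  moments_of_cumulants (fun k => c ^+ k.-1).

End Distributions.

Notation "f =+ g" := (eq_pos f g) (at level 70, no associativity).
Notation "mu [+] nu" := (free_add mu nu) (at level 50, left associativity).
Notation "mu [/] nu" := (free_mul_deconv mu nu)
  (at level 40, left associativity).

(** * Noncommutative probability spaces *)

Structure ncps (C : numClosedFieldType) := Ncps {
  ncps_alg :> algType C;
  star : ncps_alg -> ncps_alg;
  starD : forall x y, star (x + y) = star x + star y;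
  starZ : forall (k : C) x, star (k *: x) = k^* *: star x;
  starM : forall x y, star (x * y) = star y * star x;
  starK : forall x, star (star x) = x;
  phi : {scalar ncps_alg};
  phi1 : phi 1 = 1 }.

Section NCPS.
Variables (C : numClosedFieldType) (A : ncps C).
Implicit Types (a p x y : A) (S T : set A).

Definition tracial : Prop := forall x y, phi A (x * y) = phi A (y * x).

Definition projection p : Prop := p * p = p /\ star p = p.

Definition star_subalgebra T : Prop :=
  [/\ T 1,
      forall x y, T x -> T y -> T (x + y),
      forall (k : C) x, T x -> T (k *: x),
      forall x y, T x -> T y -> T (x * y) &
      forall x, T x -> T (star x)].

Definition star_alg_gen S : set A := smallest star_subalgebra S.

(* For a family T of subalgebras: the product of any nonempty sequence of
   centered elements, consecutive ones being taken from subalgebras of distinct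
   indices, is centered. *)
Definition free_family (I : eqType) (T : I -> set A) : Prop :=
  forall w : seq (I * A), w != [::] ->
    sorted (fun u v => u.1 != v.1) w ->
    (forall u, u \in w -> T u.1 u.2 /\ phi A u.2 = 0) ->
    phi A (\prod_(u <- w) u.2) = 0.

Definition star_free S T : Prop :=
  free_family (fun i : bool => if i then star_alg_gen T else star_alg_gen S).

(* kappa w is the coefficient, in the joint R-series of the family x, of the
   word w in the noncommuting variables indexed by I. The positions in a block
   B are listed by enum B in increasing order. *)
Definition joint_cumulants (I : Type) (x : I -> A) (kappa : seq I -> C) : Prop :=
  forall w : seq I, (0 < size w)%N ->
    phi A (\prod_(i <- w) x i) =
    \sum_(P in NC (size w)) \prod_(B in P)
      kappa [seq tnth (in_tuple w) j | j <- enum B].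

(* The coefficient of w in sum_(n >= 1) alpha_n ((z1 z2)^n + (z2 z1)^n), with z1
   encoded by false and z2 by true; the terms of index n > size w do not
   contribute, their words having length 2n. *)
Definition rdiag_series (alpha : nat -> C) (w : seq bool) : C :=
  \sum_(1 <= n < (size w).+1) alpha n *
    ((w == flatten (nseq n [:: false; true])) +
     (w == flatten (nseq n [:: true; false])))%:R.

Definition R_diagonal a : Prop :=
  exists alpha : nat -> C,
    joint_cumulants (fun i : bool => if i then star a else a)
                    (rdiag_series alpha).

(* The distribution of p x x^* p in (p A p, phi(p)^-1 phi). *)
Definition compressed_distr p x : nat -> C :=
  fun k => (phi A p)^-1 * phi A ((p * x * star x * p) ^+ k).

End NCPS.

(* Main.v *)
Require Import Defs.
From HB Require Import structures.
From mathcomp Require Import all_boot all_order all_algebra.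
From mathcomp Require Import zify ring.

Set Implicit Arguments.
Unset Strict Implicit.
Unset Printing Implicit Defensive.

Import Order.TTheory GRing.Theory Num.Theory.

Local Open Scope ring_scope.

(* Write F(z) and G(z) for the moment series of p x x^* p and x^* p x, with
   constant terms c = phi(p) and 1, so that G = F + 1 - c by traciality. The
   deconvolution by mu_c turns the cumulants c^-1 M(c rho) into rho, where M maps
   cumulants to moments, and rho is read off from the functional equation
     F - c = r(z F G),   rho_k = c^(k-1) r_k.
   So it suffices to see that the series r are added. Freeness and the
   R-diagonality of a give a Schwinger-Dyson equation: in phi(a W), the block of
   the leading a alternates between a and a^*, and the gaps between consecutive
   letters of the block contribute alternately F and G. For x = a + b, moving a
   this way leaves products of p, b and b^* separated by factors 1 / (1 - L), L
   depending only on the side of the gap, so that F and G are the series of b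
   evaluated at w = z / ((1 - L_0) (1 - L_1)), up to the factors 1 / (1 - L_i).
   Substituting the equation of b at w yields F - c = (alpha + r_b)(z F G). *)

(** * Sums over noncrossing partitions *)

(** Let [psi] be the moment series of [p x x^* p] in the compressed space, without its constant
    term. Then [F = c (1 + psi)] and [G = 1 + c psi], so [F - c = r(z F G)] is the functional
    equation of rectangular free convolution with ratio [c], and [r] is the rectangular R-transform
    up to normalization. The powers of [c] in [rho] come from [F] being [c] times a moment series.
    The obstacle is that [p] and [b] stand in an arbitrary relation, so nothing is known about their
    joint cumulants. Only blocks of [a] are expanded; elements of the algebra of [p] and [b] are
    opaque coefficients that fill the gaps. Sums over noncrossing partitions are rewritten as
    recursions on words that read the first block from left to right, so that each functional
    equation comes from a recursion on the length of a block. Series without constant term are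
    divided by [z], and substitution always has the form [f(z u(z))]: it is legal for every [u] and
    delays the coefficients of [u] by one degree, so the fixed-point equations have at most one
    solution. *)

Section NoncrossingSums.
Variable n : nat.
Implicit Types (A B D U V : {set 'I_n}) (P Q : {set {set 'I_n}}).

Definition crossing A B : bool :=
  [exists i in A, exists j in B, exists k in A, exists l in B,
    [&& i < j, j < k & k < l]%N].

Lemma crossingP A B :
  reflect (exists i j k l : 'I_n, [/\ i \in A, j \in B, k \in A & l \in B] /\
             [/\ i < j, j < k & k < l]%N) (crossing A B).
Proof.
apply: (iffP exists_inP) => [[i iA /exists_inP[j jB /exists_inP[k kA
  /exists_inP[l lB /and3P[ij jk kl]]]]]|[i [j [k [l [[iA jB kA lB] [ij jk kl]]]]]]].
  by exists i, j, k, l.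
exists i => //; apply/exists_inP; exists j => //; apply/exists_inP; exists k => //.
by apply/exists_inP; exists l => //; apply/and3P.
Qed.

(** Unlike [noncrossing], this makes no use of [pblock]: it applies to any family of blocks and so
    passes to subfamilies and to partitions of subsets. *)
Definition uncrossed P : bool :=
  [forall A in P, forall B in P, crossing A B ==> (A == B)].

Lemma uncrossedP P :
  reflect (forall A B, A \in P -> B \in P -> crossing A B -> A = B)
          (uncrossed P).
Proof.
apply: (iffP forall_inP) => [cr A B AP BP cAB|cr A AP].
  by have /forall_inP /(_ B BP) /implyP /(_ cAB) /eqP := cr A AP.
by apply/forall_inP => B BP; apply/implyP => /(cr _ _ AP BP) ->.
Qed.

Lemma uncrossedS P Q : P \subset Q -> uncrossed Q -> uncrossed P.
Proof.
move=> /subsetP PQ /uncrossedP cQ; apply/uncrossedP => A B /PQ AQ /PQ.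
exact: cQ.
Qed.

Lemma uncrossedU P Q : uncrossed P -> uncrossed Q ->
  (forall A B, A \in P -> B \in Q -> ~~ crossing A B /\ ~~ crossing B A) ->
  uncrossed (P :|: Q).
Proof.
move=> /uncrossedP cP /uncrossedP cQ cPQ; apply/uncrossedP => A B.
by case/setUP => [AP|AQ] /setUP[BP|BQ]; [exact: cP| | |exact: cQ] => cr;
  [have [] := cPQ A B AP BQ|have [] := cPQ B A BP AQ]; rewrite cr.
Qed.

Lemma crossingS A A' B B' :
  A \subset A' -> B \subset B' -> crossing A B -> crossing A' B'.
Proof.
move=> /subsetP AA /subsetP BB /crossingP[i [j [k [l [[iA jB kA lB] lt]]]]].
by apply/crossingP; exists i, j, k, l; split=> //; split; auto.
Qed.

Lemma partP P D : reflect
  [/\ forall B, B \in P -> B \subset D,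
      forall B, B \in P -> exists x, x \in B,
      forall x, x \in D -> exists2 B, B \in P & x \in B &
      forall A B x, A \in P -> B \in P -> x \in A -> x \in B -> A = B]
  (partition P D).
Proof.
apply: (iffP and3P) => [[/eqP cov /finset.trivIsetP tI P0]|[sub ne cov uni]]; split.
- by move=> B BP; rewrite -cov; apply: bigcup_sup.
- move=> B BP; apply/set0Pn; apply: contraNneq P0 => B0.
  by rewrite -B0.
- by move=> x; rewrite -cov => /bigcupP[B]; exists B.
- move=> A B x AP BP xA xB; apply/eqP; apply: contraT => /(tI A B AP BP).
  by move=> /disjoint_setI0 /setP /(_ x); rewrite !inE xA xB.
- rewrite eqEsubset; apply/andP; split; first by apply/bigcupsP.
  by apply/subsetP => x /cov[B BP xB]; apply/bigcupP; exists B.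
- apply/finset.trivIsetP => A B AP BP; apply: contraR.
  rewrite -setI_eq0 => /set0Pn[x /setIP[xA xB]].
  by rewrite (uni A B x).
- by apply/negP => /ne[x]; rewrite inE.
Qed.

Definition ncpart D P : bool := partition P D && uncrossed P.

Lemma ncpartT P : ncpart [set: 'I_n] P = (P \in NC n).
Proof.
rewrite inE /ncpart; case part: (partition P _) => //=.
have [/eqP cov tI _] := and3P part; have [_ _ ex _] := partP _ _ part.
have covi i : i \in finset.cover P by rewrite cov inE.
apply/uncrossedP/forallP => [cr i|nc A B AP BP].
  apply/forallP => j; apply/forallP => k; apply/forallP => l.
  apply/implyP => /and5P[ij jk kl /eqP ik /eqP jl]; apply/eqP; apply: cr.
  - exact: pblock_mem.
  - exact: pblock_mem.
  apply/crossingP; exists i, j, k, l; split=> //; split.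
  - by rewrite mem_pblock.
  - by rewrite mem_pblock.
  - by rewrite ik mem_pblock.
  - by rewrite jl mem_pblock.
move=> /crossingP[i [j [k [l [[iA jB kA lB] [ij jk kl]]]]]].
have /forallP/(_ j)/forallP/(_ k)/forallP/(_ l) := nc i.
rewrite (def_pblock tI AP iA) (def_pblock tI AP kA) (def_pblock tI BP jB).
by rewrite (def_pblock tI BP lB) ij jk kl !eqxx /= => /eqP.
Qed.

Variables (R : comNzRingType) (K : {set 'I_n} -> R).

Definition ncsum D : R := \sum_(P | ncpart D P) \prod_(B in P) K B.

Section Split.
Variables (D1 D2 : {set 'I_n}).
Hypothesis disj : [disjoint D1 & D2].

Let disjN x : x \in D1 -> x \in D2 -> false.
Proof. by move=> x1 x2; move/pred0P: disj => /(_ x) /=; rewrite x1 x2. Qed.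

Lemma part_glue P1 P2 : partition P1 D1 -> partition P2 D2 ->
  [/\ partition (P1 :|: P2) (D1 :|: D2),
      (P1 :|: P2) ::&: D1 = P1 & (P1 :|: P2) ::&: D2 = P2].
Proof.
move=> /partP[s1 n1 c1 u1] /partP[s2 n2 c2 u2]; split.
- apply/partP; split.
  + move=> B /setUP[/s1|/s2] sB; apply: fintype.subset_trans sB _;
      [exact: subsetUl|exact: subsetUr].
  + by move=> B /setUP[/n1|/n2].
  + by move=> x /setUP[/c1|/c2] [B BP xB]; exists B; rewrite // inE BP ?orbT.
  move=> A B x /setUP[AP|AP] /setUP[BP|BP] xA xB; first exact: u1 xA xB.
  + have x1 := subsetP (s1 A AP) x xA; have x2 := subsetP (s2 B BP) x xB.
    by have := disjN x1 x2.
  + have x1 := subsetP (s1 B BP) x xB; have x2 := subsetP (s2 A AP) x xA.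
    by have := disjN x1 x2.
  + exact: u2 xA xB.
- apply/setP => B; rewrite !inE; apply/andP/idP => [[/orP[//|BP]] /subsetP sB|BP].
    have [x xB] := n2 B BP; have x2 := subsetP (s2 B BP) x xB.
    by have := disjN (sB x xB) x2.
  by rewrite BP s1.
- apply/setP => B; rewrite !inE; apply/andP/idP => [[/orP[BP|//]] /subsetP sB|BP].
    have [x xB] := n1 B BP; have x1 := subsetP (s1 B BP) x xB.
    by have := disjN x1 (sB x xB).
  by rewrite BP orbT s2.
Qed.

Lemma part_cut P : partition P (D1 :|: D2) ->
    P = (P ::&: D1) :|: (P ::&: D2) ->
  partition (P ::&: D1) D1 /\ partition (P ::&: D2) D2.
Proof.
move=> /partP[s ne c u] PE; split; apply/partP; split=>
  [B|B|x xD|A B x]; rewrite ?inE; try by move=> /andP[].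
- by move=> /andP[/ne].
- have [|B BP xB] := c x; first by rewrite inE xD.
  exists B => //; move: BP; rewrite {1}PE => /setUP[//|]; rewrite inE => /andP[_].
  by move=> /subsetP/(_ x xB) x2; have := disjN xD x2.
- by move=> /andP[AP _] /andP[BP _]; apply: u.
- by move=> /andP[/ne].
- have [|B BP xB] := c x; first by rewrite inE xD orbT.
  exists B => //; move: BP; rewrite {1}PE => /setUP[|//]; rewrite inE => /andP[_].
  by move=> /subsetP/(_ x xB) x2; have := disjN x2 xD.
- by move=> /andP[AP _] /andP[BP _]; apply: u.
Qed.

(** A partition with no block meeting both [D1] and [D2] is a pair of partitions, and its weight is
    the product of theirs. The predicate [c] restricts the second one enough for every such pair to
    glue to a noncrossing partition. *)
Lemma ncsum_split (c : pred {set {set 'I_n}}) :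
  (forall P1 P2, ncpart D1 P1 -> ncpart D2 P2 -> c P2 ->
     uncrossed (P1 :|: P2)) ->
  \sum_(P | [&& ncpart (D1 :|: D2) P, P == (P ::&: D1) :|: (P ::&: D2)
              & c (P ::&: D2)]) \prod_(B in P) K B =
  ncsum D1 * \sum_(P | ncpart D2 P && c P) \prod_(B in P) K B.
Proof.
move=> cc; rewrite (partition_big (fun P => P ::&: D1) (ncpart D1)) /=; last first.
  move=> P /and3P[/andP[part cr] /eqP PE _]; rewrite /ncpart.
  rewrite (proj1 (part_cut part PE)) /=; apply: uncrossedS cr.
  by apply/subsetP => B; rewrite inE => /andP[].
rewrite /ncsum big_distrlr /=; apply: eq_bigr => P1 nc1.
rewrite (reindex_onto (fun P2 => P1 :|: P2) (fun P => P ::&: D2)) /=; last first.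
  by move=> P /andP[/and3P[_ /eqP PE _] /eqP <-]; apply/esym.
apply: eq_big => [P2|P2 /andP[/andP[_ /eqP lo] /eqP hi]].
  apply/idP/idP => [|/andP[nc2 c2]].
    move=> /andP[/andP[/and3P[/andP[part cr] /eqP PE c2] /eqP lo] /eqP hi].
    rewrite hi in c2; rewrite c2 andbT /ncpart -{1}hi.
    rewrite (proj2 (part_cut part PE)) /=; apply: uncrossedS cr.
    exact: subsetUr.
  have [/andP[p1 cr1] /andP[p2 cr2]] := (nc1, nc2).
  have [p12 lo hi] := part_glue p1 p2.
  by rewrite lo hi !eqxx c2 /ncpart p12 cc.
rewrite (eq_bigl [predU P1 & P2]) => [|B]; last by rewrite !inE.
rewrite bigU //= -setI_eq0; apply/eqP/setP => B; rewrite in_setI in_set0.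
apply/negP => /andP[B1 B2].
have /andP[/partP[s1 n1 _ _] _] := nc1; have [x xB] := n1 B B1.
move: B2; rewrite -hi inE => /andP[_ s2].
by have := disjN (subsetP (s1 B B1) x xB) (subsetP s2 x xB).
Qed.

End Split.
End NoncrossingSums.

(** * Reading the block of the first point *)

Section Scanning.
Variables (n : nat) (R : comNzRingType) (K : {set 'I_n} -> R).
Implicit Types (A B D U V : {set 'I_n}) (P Q : {set {set 'I_n}}).

Definition set_lt A B : Prop := forall i j, i \in A -> j \in B -> (i < j)%N.

(* Reading a block from left to right: U is the part already read, V the points
   skipped since, and D the points still to come. *)
Definition scan_sum U V D : R :=
  \sum_(P | ncpart (U :|: V :|: D) P &&
            [exists B in P, (U \subset B) && [disjoint B & V]])
    \prod_(B in P) K B.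

Lemma disjointN A B x : [disjoint A & B] -> x \in A -> x \in B -> false.
Proof. by move=> /pred0P /(_ x) /= + xA xB; rewrite xA xB. Qed.

Lemma disjointP A B : (forall x, x \in A -> x \in B -> false) -> [disjoint A & B].
Proof.
move=> AB; rewrite -setI_eq0; apply/eqP/setP => x; rewrite !inE.
by apply/negP => /andP[xA xB]; have := AB x xA xB.
Qed.

Lemma set_lt_disjoint A B : set_lt A B -> [disjoint A & B].
Proof. by move=> AB; apply: disjointP => x xA xB; have := AB x x xA xB; rewrite ltnn. Qed.

Lemma ncsum0 : ncsum K set0 = 1.
Proof.
rewrite /ncsum (big_pred1 set0) ?big_set0 // => P; apply/idP/eqP => [|->].
  move=> /andP[/partP[s n0 _ _] _]; apply/setP => B; rewrite inE.
  apply/negP => BP; have [x xB] := n0 B BP.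
  by have := subsetP (s B BP) x xB; rewrite inE.
apply/andP; split; first by apply/partP; split=> [B|B|x|A B x]; rewrite inE.
by apply/uncrossedP => A B; rewrite inE.
Qed.

(** With nothing left to read, the current block contains [U] and avoids [V], hence equals [U];
    since [U] precedes [V], the partition of [V] is free. *)
Lemma scan_sum0 U V : U != set0 -> set_lt U V ->
  scan_sum U V set0 = K U * ncsum K V.
Proof.
move=> U0 UV; have dVU : [disjoint V & U].
  by rewrite disjoint_sym; apply: set_lt_disjoint.
have [u0 u0U] := set0Pn _ U0.
have part1 : partition [set U] U.
  apply/partP; split=> [B|B|x xU|A B x]; first by rewrite inE => /eqP->.
  - by rewrite inE => /eqP->; exists u0.
  - by exists U; rewrite ?inE.
  - by rewrite !inE => /eqP-> /eqP->.
have nc1 : ncpart U [set U].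
  rewrite /ncpart part1; apply/uncrossedP => A B.
  by rewrite !inE => /eqP-> /eqP->.
transitivity (ncsum K V * \sum_(P | ncpart U P && (P == [set U]))
                            \prod_(B in P) K B); last first.
  rewrite (big_pred1 [set U]) ?big_set1 1?mulrC // => P /=.
  by case: eqP => [->|_]; rewrite ?nc1 ?andbF.
rewrite -(ncsum_split K dVU) => [|P1 P2 /andP[/partP[s1 _ _ _] cr1] /andP[_ cr2]].
  apply: eq_bigl => P; rewrite finset.setU0 (finset.setUC U).
  case nc: (ncpart _ _) => //=.
  have /andP[/partP[s ne c u] cr] := nc.
  apply/exists_inP/andP => [[B BP /andP[UB dBV]]|[/eqP PE /eqP hi]].
    have BU : B = U.
      apply/eqP; rewrite eqEsubset UB andbT; apply/subsetP => x xB.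
      have := subsetP (s B BP) x xB; rewrite inE => /orP[xV|//].
      by have := disjointN dBV xB xV.
    subst B; have other A : A \in P -> A != U -> A \subset V.
      move=> AP /eqP AU; apply/subsetP => x xA.
      have := subsetP (s A AP) x xA; rewrite inE => /orP[//|xU].
      by case: AU; apply: u xA xU.
    split; apply/eqP/setP => A; rewrite !inE.
      apply/idP/orP => [AP|[]/andP[]//].
      case: (eqVneq A U) => [->|/(other A AP) AV]; [right|left].
        by rewrite BP fintype.subxx.
      by rewrite AP.
    apply/andP/eqP => [[AP AU]|->]; last by split.
    have [x xA] := ne A AP; exact: u xA (subsetP AU x xA).
  have : U \in P ::&: U by rewrite hi inE.
  by rewrite inE => /andP[UP _]; exists U; rewrite // fintype.subxx disjoint_sym.
move=> /eqP PE; subst P2; apply: uncrossedU => // A B AP1; rewrite inE => /eqP->.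
split; apply/negP => /crossingP[i [j [k [l [[iA jB kA lB] [ij jk kl]]]]]].
  by have := UV _ _ jB (subsetP (s1 A AP1) i iA); rewrite ltnNge ltnW.
by have := UV _ _ kA (subsetP (s1 A AP1) j jB); rewrite ltnNge ltnW.
Qed.

(** If the current block takes [j], then [V] is enclosed between two of its points, so blocks
    meeting [V] stay inside [V] and factor out. Otherwise [j] becomes one more skipped point. *)
Lemma scan_sumS U V j D : U != set0 -> set_lt U V ->
    set_lt (U :|: V) [set j] -> set_lt [set j] D ->
  scan_sum U V (j |: D) =
    ncsum K V * scan_sum (j |: U) set0 D + scan_sum U (j |: V) D.
Proof.
move=> /set0Pn[u0 u0U] UV UVj jD.
have ltUj u : u \in U -> (u < j)%N.
  by move=> uU; apply: UVj; rewrite ?inE ?uU ?eqxx.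
have ltVj v : v \in V -> (v < j)%N.
  by move=> vV; apply: UVj; rewrite ?inE ?vV ?orbT ?eqxx.
have ltjD d : d \in D -> (j < d)%N by move=> dD; apply: jD; rewrite ?inE ?eqxx.
have aboveW x v v' : x \in (j |: U) :|: D -> v \in V -> v' \in V ->
    (v < x)%N -> (v' < x)%N.
  move=> /setUP[/setU1P[->|xU]|xD] vV v'V; first by rewrite !ltVj.
    by rewrite ltnNge ltnW // UV.
  by move=> _; apply: ltn_trans (ltVj v' v'V) (ltjD x xD).
have dVW : [disjoint V & (j |: U) :|: D].
  apply: disjointP => x xV /setUP[/setU1P[xj|xU]|xD].
  - by have := ltVj x xV; rewrite xj ltnn.
  - by have := UV x x xU xV; rewrite ltnn.
  - by have := ltn_trans (ltVj x xV) (ltjD x xD); rewrite ltnn.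
pose joined P := [exists B in P, (U \subset B) && (j \in B)].
rewrite {1}/scan_sum (bigID joined) /=; congr (_ + _).
  rewrite /scan_sum finset.setU0.
  rewrite -(ncsum_split K dVW) => [|P1 P2 /andP[/partP[s1 _ _ _] cr1]
    /andP[/partP[s2 _ _ _] cr2] _]; last first.
    apply: uncrossedU => // A B AP BP.
    split; apply/negP => /crossingP[i [k [l [m [[iA jB kA lB] [ij jk kl]]]]]].
      have := aboveW k i l (subsetP (s2 B BP) k jB) (subsetP (s1 A AP) i iA)
        (subsetP (s1 A AP) l kA) ij.
      by rewrite ltnNge ltnW.
    have := aboveW l k m (subsetP (s2 B BP) l kA) (subsetP (s1 A AP) k jB)
      (subsetP (s1 A AP) m lB) jk.
    by rewrite ltnNge ltnW.
  apply: eq_bigl => P.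
  have -> : U :|: V :|: (j |: D) = V :|: (j |: U :|: D).
    by apply/setP => x; rewrite !inE; do !case: (_ \in _); case: (_ == _).
  case nc: (ncpart _ _) => //=; have /andP[/partP[s ne c u] /uncrossedP cr] := nc.
  apply/andP/andP => [[/exists_inP[B BP /andP[UB dBV]]
    /exists_inP[B' B'P /andP[UB' jB']]]|].
    have BB' : B = B' by apply: u (subsetP UB u0 u0U) (subsetP UB' u0 u0U).
    subst B'; have inV A x : A \in P -> x \in A -> x \in V -> A \subset V.
      move=> AP xA xV; apply/subsetP => y yA.
      have := subsetP (s A AP) y yA; rewrite 3!inE => /orP[//|/orP[yjU|yD]].
        have yB : y \in B by move: yjU; rewrite !inE => /orP[/eqP->|/(subsetP UB)].
        have AB := u A B y AP BP yA yB; subst A.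
        by have := disjointN dBV xA xV.
      (* [x] in [V] lies between the points [u0] and [j] of [B], while [y] in [D] lies beyond
         [j]. *)
      have crBA : crossing B A.
        apply/crossingP; exists u0, x, j, y; split; split=> //.
        - exact: subsetP UB u0 u0U.
        - exact: UV.
        - exact: ltVj.
        - exact: ltjD.
      have AB := cr B A BP AP crBA; subst A.
      by have := disjointN dBV xA xV.
    split; last first.
      apply/exists_inP; exists B.
        rewrite inE BP; apply/subsetP => x xB.
        have := subsetP (s B BP) x xB; rewrite inE => /orP[xV|//].
        by have := disjointN dBV xB xV.
      apply/andP; split; first by rewrite subUset sub1set jB'.
      by apply: disjointP => x _; rewrite inE.
    apply/eqP/setP => A; rewrite !inE -andb_orr.
    case AP: (A \in P) => //=; apply/esym.
    case: (boolP (A \subset V)) => //= /subsetPn[y yA yV].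
    apply/subsetP => x xA; have := subsetP (s A AP) x xA.
    rewrite inE => /orP[xV|//].
    by have := subsetP (inV A x AP xA xV) y yA; rewrite (negbTE yV).
  move=> [/eqP PE /exists_inP[B]]; rewrite inE => /andP[BP BW] /andP[jUB _].
  move: jUB; rewrite subUset sub1set => /andP[jB UB]; split.
    apply/exists_inP; exists B => //; rewrite UB /=.
    by apply: disjointP => x /(subsetP BW) xW xV; have := disjointN dVW xV xW.
  by apply/exists_inP; exists B => //; rewrite UB jB.
rewrite /scan_sum; apply: eq_bigl => P.
have -> : U :|: V :|: (j |: D) = U :|: (j |: V) :|: D.
  by apply/setP => x; rewrite !inE; do !case: (_ \in _); case: (_ == _).
case nc: (ncpart _ _) => //=; have /andP[/partP[s ne c u] _] := nc.
apply/andP/exists_inP => [[/exists_inP[B BP /andP[UB dBV]] nj]|[B BP /andP[UB dB]]].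
  exists B => //; rewrite UB /=; apply: disjointP => x xB /setU1P[xj|xV].
    by case/exists_inP: nj; exists B; rewrite // UB -xj.
  exact: disjointN dBV xB xV.
split.
  apply/exists_inP; exists B; rewrite // UB /=.
  by apply: disjointP => x xB xV; apply: (disjointN dB xB); rewrite inE xV orbT.
apply/exists_inP => -[B' B'P /andP[UB' jB']].
have BB' : B = B' by apply: u (subsetP UB u0 u0U) (subsetP UB' u0 u0U).
by subst B'; have := disjointN dB jB'; rewrite !inE eqxx => /(_ isT).
Qed.

Lemma ncsum_scan i D : set_lt [set i] D ->
  ncsum K (i |: D) = scan_sum [set i] set0 D.
Proof.
move=> iD; rewrite /scan_sum finset.setU0; apply: eq_bigl => P.
case nc: (ncpart _ _) => //=; have /andP[/partP[_ _ c _] _] := nc.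
have [|B BP iB] := c i; first by rewrite !inE eqxx.
apply/esym/exists_inP; exists B; rewrite // sub1set iB.
by apply: disjointP => x _; rewrite inE.
Qed.

End Scanning.
(** * Moments of words from cumulants *)

Section Moments.
Variables (R : comNzRingType) (I : Type) (kappa : seq I -> R).
Implicit Types (u v w : seq I) (mm : seq I -> R).

(* Reading w with a current block carrying the word u, and the letters skipped
   since the last letter of that block forming the word v. *)
Fixpoint scan mm u v w : R :=
  if w is j :: w' then mm v * scan mm (rcons u j) [::] w' +
                       scan mm u (rcons v j) w'
  else kappa u * mm v.

(** [k] is fuel: the recursive calls are on gaps, which are shorter than [w] but are not subterms of
    it. *)
Fixpoint moment_rec k w : R :=
  if k is k'.+1 then
    if w is i :: w' then scan (moment_rec k') [:: i] [::] w' else 1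
  else 1.

Definition moment w : R := moment_rec (size w) w.

Lemma eq_scan m mm mm' u v w :
    (forall v, (size v <= m)%N -> mm v = mm' v) -> (size v + size w <= m)%N ->
  scan mm u v w = scan mm' u v w.
Proof.
move=> eqm; elim: w u v => [|j w IH] u v /=; first by rewrite addn0 => /eqm ->.
move=> /= lem; rewrite eqm ?IH ?size_rcons //=; lia.
Qed.

Lemma eq_moment_rec k k' w : (size w <= k)%N -> (size w <= k')%N ->
  moment_rec k w = moment_rec k' w.
Proof.
elim: k k' w => [|k IH] [|k'] [|i w] //= wk wk'.
apply: (@eq_scan (size w)) => // v vw.
by apply: IH; apply: leq_trans vw _.
Qed.

Lemma moment_nil : moment [::] = 1. Proof. by []. Qed.

Lemma moment_cons i w : moment (i :: w) = scan moment [:: i] [::] w.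
Proof.
by apply: (@eq_scan (size w)) => // v vw; apply: eq_moment_rec.
Qed.

End Moments.

Section WordSums.
Variable n : nat.
Implicit Types D U V : {set 'I_n}.

Let ltI : rel 'I_n := fun i j => (i < j)%N.

Lemma sorted_enum_set D : sorted ltI (enum D).
Proof.
rewrite {1}/enum_mem; apply: sorted_filter; first by move=> i j k; apply: ltn_trans.
have : sorted ltn (map val (enum 'I_n)) by rewrite val_enum_ord; apply: iota_ltn_sorted.
by rewrite sorted_map enumT.
Qed.

Lemma enum_set_eq D s : sorted ltI s -> D =i s -> enum D = s.
Proof.
move=> ss Ds; apply: (@irr_sorted_eq _ ltI) => //.
- by move=> i j k; apply: ltn_trans.
- by move=> i; apply: ltnn.
- exact: sorted_enum_set.
- by move=> i; rewrite mem_enum Ds.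
Qed.

Lemma enum_set_min j D : set_lt [set j] D -> enum (j |: D) = j :: enum D.
Proof.
move=> jD; apply: enum_set_eq => [|i]; last by rewrite !inE mem_enum.
rewrite /= path_sortedE; last by move=> i k l; apply: ltn_trans.
rewrite sorted_enum_set andbT; apply/allP => i; rewrite mem_enum => iD.
by apply: jD; rewrite ?inE.
Qed.

Lemma enum_set_max j U : set_lt U [set j] -> enum (j |: U) = rcons (enum U) j.
Proof.
move=> Uj; apply: enum_set_eq => [|i]; last first.
  by rewrite mem_rcons !inE mem_enum.
have := sorted_enum_set U; have : all (ltI^~ j) (enum U).
  by apply/allP => i; rewrite mem_enum => iU; apply: Uj; rewrite ?inE.
case: (enum U) => //= i s /andP[ij sj] pis; rewrite rcons_path pis /=.
by case/lastP: s sj {pis} => //= s l; rewrite all_rcons last_rcons => /andP[].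
Qed.

Lemma set_ltU U V D : set_lt (U :|: V) D <-> set_lt U D /\ set_lt V D.
Proof.
split=> [h|[hU hV] i j /setUP[]]; [|exact: hU|exact: hV].
by split=> i j iU; apply: h; rewrite inE iU ?orbT.
Qed.

Lemma set_ind_min D : D = set0 \/
  exists j D', [/\ D = j |: D', set_lt [set j] D' & #|D| = #|D'|.+1].
Proof.
have [->|/set0Pn[i0 i0D]] := eqVneq D set0; [by left|right].
case: (arg_minnP (fun i : 'I_n => val i) i0D) => j jmem minj.
have jD : j \in D := jmem.
exists j, (D :\ j); split; first by rewrite setD1K.
  move=> i k; rewrite !inE => /eqP-> /andP[kj kD].
  by rewrite ltn_neqAle minj // andbT; apply: contraNneq kj => /val_inj->.
by rewrite (cardsD1 j) jD.
Qed.

Variables (R : comNzRingType) (I : Type) (kappa : seq I -> R) (x : 'I_n -> I).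

Let word D := [seq x i | i <- enum D].
Let K D := kappa (word D).

(** [scan] mirrors [scan_sumS]: the least point of [D] lies above [U] and [V], so its letter is
    appended to the word of one of them. The first hypothesis evaluates the closed gaps and is the
    induction hypothesis of [ncsum_moment]. *)
Lemma scan_sum_moment k D U V :
    (forall D, (#|D| < k)%N -> ncsum K D = moment kappa (word D)) ->
    (#|V| + #|D| < k)%N -> U != set0 -> set_lt U V -> set_lt (U :|: V) D ->
  scan_sum K U V D =
    scan kappa (moment kappa) (word U) (word V) (word D).
Proof.
move=> IH; have [m] := ubnP #|D|; elim: m D U V => // m IHm D U V.
case: (set_ind_min D) => [->|[j [D' [-> jD' ->]]]] leD leVD U0 UV UVD.
  rewrite scan_sum0 // /word enum_set0 /= IH //.
  exact: leq_ltn_trans (leq_addr _ _) leVD.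
have jUV : set_lt (U :|: V) [set j].
  by move=> i l iUV; rewrite inE => /eqP->; apply: UVD iUV (setU11 j D').
have [Uj Vj] := (set_ltU U V [set j]).1 jUV.
have [UD VD] := (set_ltU U V (j |: D')).1 UVD.
have UD' : set_lt U D' by move=> i l iU lD; apply: UD iU (setU1r _ lD).
have VD' : set_lt V D' by move=> i l iU lD; apply: VD iU (setU1r _ lD).
have cardV : #|j |: V| = #|V|.+1.
  rewrite cardsU1; case jV: (j \in V) => //.
  by have := Vj j j jV (set11 j); rewrite ltnn.
have -> : word (j |: D') = x j :: word D' by rewrite /word enum_set_min.
rewrite scan_sumS //= IH; last exact: leq_ltn_trans (leq_addr _ _) leVD.
congr (_ * _ + _).
  rewrite IHm ?cards0 //; try lia.
  - by rewrite /word enum_set0 (enum_set_max Uj) map_rcons.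
  - by apply/set0Pn; exists j; rewrite !inE eqxx.
  - by move=> a b _; rewrite inE.
  - by rewrite finset.setU0 set_ltU.
rewrite IHm ?cardV //; try lia.
- by rewrite /word (enum_set_max Vj) map_rcons.
- by move=> a b aU /setU1P[->|bV]; [apply: Uj; rewrite ?inE|apply: UV].
- by rewrite set_ltU; split=> //; rewrite set_ltU.
Qed.

Lemma ncsum_moment D : ncsum K D = moment kappa (word D).
Proof.
have [k] := ubnP #|D|; elim: k D => // k IH D.
case: (set_ind_min D) => [->|[j [D' [-> jD' ->]]]] leD.
  by rewrite ncsum0 /word enum_set0.
have -> : word (j |: D') = x j :: word D' by rewrite /word enum_set_min.
rewrite ncsum_scan // moment_cons.
rewrite (scan_sum_moment IH) ?cards0 //.
- by rewrite /word enum_set1 enum_set0.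
- by apply/set0Pn; exists j; rewrite inE.
- by move=> a b _; rewrite inE.
- by rewrite finset.setU0.
Qed.

End WordSums.

(** * The Kreweras complement *)

Section Refinement.
Variables (n : nat) (R : comNzRingType) (K : {set 'I_n} -> R).
Implicit Types P Q : {set {set 'I_n}}.

Lemma refinesP P Q :
  reflect (forall B, B \in P -> exists2 D, D \in Q & B \subset D) (refines P Q).
Proof.
apply: (iffP forall_inP) => [h B /h /exists_inP[D]|h B /h [D DQ BD]].
  by exists D.
by apply/exists_inP; exists D.
Qed.

(** Subsets of two distinct blocks of [Q] cannot cross, since those blocks do not; the blocks of [Q]
    are therefore partitioned independently, and [ncsum_split] peels them off one at a time. *)
Lemma ncsum_refine Q : uncrossed Q -> finset.trivIset Q -> finset.set0 \notin Q ->
  \sum_(P | ncpart (finset.cover Q) P && refines P Q) \prod_(B in P) K B =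
  \prod_(D in Q) ncsum K D.
Proof.
have [k] := ubnP #|Q|; elim: k Q => // k IH Q leQ crQ tQ nQ.
have [Q0|/set0Pn[D DQ]] := eqVneq Q finset.set0.
  rewrite Q0 big_set0; transitivity (ncsum K finset.set0); last exact: ncsum0.
  have -> : finset.cover finset.set0 = finset.set0 :> {set 'I_n}.
    by rewrite /finset.cover big_set0.
  rewrite /ncsum; apply: eq_bigl => P; case nc: (ncpart _ _) => //=.
  apply/refinesP => B BP.
  have /andP[/partP[s ne _ _] _] := nc; have [x xB] := ne B BP.
  by have := subsetP (s B BP) x xB; rewrite inE.
pose Q' := Q :\ D.
have QE : Q = D |: Q' by rewrite setD1K.
have Q'Q : Q' \subset Q by apply: subD1set.
have crQ' : uncrossed Q' := uncrossedS Q'Q crQ.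
have tQ' : finset.trivIset Q' := finset.trivIsetS Q'Q tQ.
have nQ' : finset.set0 \notin Q' by apply: contra nQ => /(subsetP Q'Q).
have covE : finset.cover Q = D :|: finset.cover Q'.
  by rewrite /finset.cover (big_setD1 D).
have dis : [disjoint D & finset.cover Q'].
  apply: disjointP => x xD /bigcupP[B]; rewrite !inE => /andP[/eqP BD BQ] xB.
  have := finset.trivIsetP tQ B D BQ DQ; case: eqP => // _ /(_ isT).
  by move=> /disjointN /(_ xB xD).
rewrite (big_setD1 D) //= -IH //; last by move: leQ; rewrite (cardsD1 D) DQ.
rewrite -(ncsum_split K dis) => [|P1 P2 nc1 nc2 /refinesP ref2]; last first.
  have /andP[/partP[s1 _ _ _] cr1] := nc1.
  have /andP[/partP[s2 ne2 _ _] cr2] := nc2.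
  apply: uncrossedU => // A B AP BP.
  have [E EQ BE] := ref2 B BP; have EQ0 := subsetP Q'Q E EQ.
  have nDE : D <> E by move=> DE; move: EQ; rewrite DE !inE eqxx.
  split; apply/negP => cr.
    by apply: nDE; apply: (uncrossedP _ crQ) => //; apply: crossingS cr; auto.
  by apply: nDE; apply/esym/(uncrossedP _ crQ) => //; apply: crossingS cr; auto.
apply: eq_bigl => P; rewrite covE; case nc: (ncpart _ _) => //=.
have /andP[/partP[s ne c u] cr] := nc.
apply/refinesP/andP => [ref|[/eqP PE /refinesP ref] B BP].
  split; last first.
    apply/refinesP => B; rewrite inE => /andP[BP BQ'].
    have [E EQ BE] := ref B BP; exists E => //; rewrite QE in EQ.
    case/setU1P: EQ => // ED; have [x xB] := ne B BP.
    have xD : x \in D by rewrite -ED (subsetP BE).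
    by have := disjointN dis xD (subsetP BQ' x xB).
  apply/eqP/setP => B; rewrite !inE; case BP: (B \in P) => //=; apply/esym.
  have [E EQ BE] := ref B BP; rewrite QE in EQ.
  case/setU1P: EQ => [<-|EQ]; first by rewrite BE.
  by apply/orP; right; apply: fintype.subset_trans BE (bigcup_sup _ EQ).
move: BP; rewrite PE => /setUP[]; first by rewrite inE => /andP[_ BD]; exists D.
by move=> /ref[E EQ BE]; exists E => //; apply: (subsetP Q'Q).
Qed.

End Refinement.

Section MonotoneImage.
Variables (m N : nat) (f : 'I_m -> 'I_N).
Hypothesis f_mono : forall i j, (f i < f j)%N = (i < j)%N.
Implicit Types (A B D : {set 'I_m}) (P : {set {set 'I_m}}).

Lemma mono_ord_inj : injective f.
Proof.
move=> i j fij; apply: ord_inj; have := f_mono i j; have := f_mono j i.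
by rewrite fij ltnn; lia.
Qed.

Let mem_f x A : (f x \in [set f i | i in A]) = (x \in A).
Proof. exact: mem_imset mono_ord_inj. Qed.

Lemma crossing_imset A B :
  crossing [set f i | i in A] [set f i | i in B] = crossing A B.
Proof.
apply/crossingP/crossingP => [[_ [_ [_ [_ [[/imsetP[i iA ->] /imsetP[j jB ->]
  /imsetP[k kA ->] /imsetP[l lB ->]]]]]]]|[i [j [k [l [[iA jB kA lB] lt]]]]]].
  by rewrite !f_mono => lt; exists i, j, k, l.
by exists (f i), (f j), (f k), (f l); rewrite !f_mono !mem_f.
Qed.

Lemma part_imset P D : partition P D ->
  partition [set [set f i | i in B] | B : {set 'I_m} in P] [set f i | i in D].
Proof.
move=> /partP[s ne c u]; apply/partP; split.
- by move=> _ /imsetP[B BP ->]; apply/imsetS/s.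
- by move=> _ /imsetP[B BP ->]; have [x xB] := ne B BP; exists (f x); rewrite mem_f.
- move=> _ /imsetP[x xD ->]; have [B BP xB] := c x xD.
  exists [set f i | i in B]; last by rewrite mem_f.
  by apply/imsetP; exists B.
- move=> _ _ _ /imsetP[A AP ->] /imsetP[B BP ->] /imsetP[x xA ->].
  by rewrite mem_f => xB; congr imset; rewrite (u A B x).
Qed.

Definition preim_blocks (Q : {set {set 'I_N}}) : {set {set 'I_m}} :=
  [set B : {set 'I_m} | [set f i | i in B] \in Q].

Lemma preim_blocks_NC (Q : {set {set 'I_N}}) : Q \in NC N ->
    (forall (B : {set 'I_N}) x,
       B \in Q -> f x \in B -> B \subset [set f i | i in 'I_m]) ->
  preim_blocks Q \in NC m.
Proof.
rewrite -!ncpartT => /andP[/partP[s ne c u] /uncrossedP cr] hom.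
apply/andP; split; last first.
  apply/uncrossedP => A B; rewrite !inE => AQ BQ.
  rewrite -crossing_imset => /(cr _ _ AQ BQ).
  by move/setP => AB; apply/setP => x; have := AB (f x); rewrite !mem_f.
apply/partP; split.
- by move=> B _; apply: subsetT.
- by move=> B; rewrite inE => /ne[_ /imsetP[x xB _]]; exists x.
- move=> x _; have [|B BQ xB] := c (f x); first by rewrite inE.
  have BE : [set f i | i in f @^-1: B] = B.
    apply/setP => y; apply/imsetP/idP => [[z]|yB]; first by rewrite inE => fz ->.
    have /imsetP[z _ yz] := subsetP (hom B x BQ xB) y yB.
    by exists z; rewrite // inE -yz.
  by exists (f @^-1: B); rewrite !inE ?BE.
- move=> A B x; rewrite !inE => AQ BQ xA xB.
  have AB := u _ _ (f x) AQ BQ; rewrite !mem_f in AB; apply/setP => y.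
  by have /setP/(_ (f y)) := AB xA xB; rewrite !mem_f.
Qed.

End MonotoneImage.

Section Kreweras.
Variable n : nat.
Implicit Types (A B D : {set 'I_n}) (P Q : {set {set 'I_n}}).

Lemma pos_mono (i j : 'I_n) : (pos i < pos j)%N = (i < j)%N.
Proof. by rewrite /= ltn_double. Qed.
Lemma pos_bar_mono (i j : 'I_n) : (pos_bar i < pos_bar j)%N = (i < j)%N.
Proof. by rewrite /= ltnS ltn_double. Qed.

Definition evenB : {set 'I_(n.*2)} := [set pos i | i in [set: 'I_n]].
Definition oddB : {set 'I_(n.*2)} := [set pos_bar i | i in [set: 'I_n]].

Lemma pos_neq_bar (i j : 'I_n) : pos i <> pos_bar j.
Proof. by move=> /(congr1 (fun k : 'I_(n.*2) => odd k)); rewrite /= !odd_double. Qed.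

Lemma even_odd_disjoint : [disjoint evenB & oddB].
Proof.
by apply: disjointP => x /imsetP[i _ ->] /imsetP[j _] /pos_neq_bar.
Qed.

Lemma even_odd_cover : evenB :|: oddB = [set: 'I_(n.*2)].
Proof.
apply/setP => k; rewrite !inE; apply/orP.
have lt : (k./2 < n)%N by have := ltn_ord k; lia.
case ok: (odd k); [right|left]; apply/imsetP; exists (Ordinal lt); rewrite ?inE //;
  apply/val_inj => /=; have := odd_double_half k; rewrite ok /=; lia.
Qed.

Lemma interleave_part P Q : partition P [set: 'I_n] -> partition Q [set: 'I_n] ->
  partition (interleave P Q) [set: 'I_(n.*2)].
Proof.
move=> /(part_imset pos_mono) pP /(part_imset pos_bar_mono) pQ.
by have [] := part_glue even_odd_disjoint pP pQ; rewrite even_odd_cover.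
Qed.

Lemma imset_pos_neq A B :
  A != finset.set0 -> [set pos i | i in A] <> [set pos_bar i | i in B].
Proof.
move=> /set0Pn[x xA] /setP /(_ (pos x)); rewrite imset_f //.
by move=> /esym/imsetP[y _ /pos_neq_bar].
Qed.

Lemma interleave_NC P Q : P \in NC n -> Q \in NC n ->
  reflect (forall B D, B \in P -> D \in Q ->
             ~~ crossing [set pos i | i in B] [set pos_bar i | i in D] /\
             ~~ crossing [set pos_bar i | i in D] [set pos i | i in B])
          (interleave P Q \in NC n.*2).
Proof.
rewrite -!ncpartT => /andP[pP cP] /andP[pQ cQ].
have /partP[_ neP _ _] := pP.
have imcr (f : 'I_n -> 'I_(n.*2)) (S : {set {set 'I_n}}) :
    (forall i j, (f i < f j)%N = (i < j)%N) ->
  uncrossed S -> uncrossed [set [set f i | i in B] | B : {set 'I_n} in S].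
  move=> fm /uncrossedP cS; apply/uncrossedP => _ _ /imsetP[A AS ->] /imsetP[B BS ->].
  by rewrite crossing_imset // => /(cS _ _ AS BS) ->.
rewrite /ncpart interleave_part //=; apply: (iffP idP) => [/uncrossedP cr B D BP DQ|cr].
  have [x xB] := neP B BP; have B0 : B != finset.set0 by apply/set0Pn; exists x.
  have BI : [set pos i | i in B] \in interleave P Q.
    by rewrite inE; apply/orP; left; apply/imsetP; exists B.
  have DI : [set pos_bar i | i in D] \in interleave P Q.
    by rewrite inE; apply/orP; right; apply/imsetP; exists D.
  split; apply/negP => c; first exact: imset_pos_neq (cr _ _ BI DI c).
  exact: imset_pos_neq (esym (cr _ _ DI BI c)).
apply: uncrossedU; [exact: imcr pos_mono cP|exact: imcr pos_bar_mono cQ|].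
by move=> _ _ /imsetP[B BP ->] /imsetP[D DQ ->]; apply: cr.
Qed.

(** The point [x] sits at [2x] and [i'] at [2i+1], so [x] precedes [i'] when [x <= i], but [i']
    precedes [y] only when [i < y]. *)
Lemma crossing_pos_bar B D : reflect
  (exists x y i j : 'I_n, [/\ x \in B, y \in B, i \in D & j \in D] /\
     [/\ x <= i, i < y & y <= j]%N)
  (crossing [set pos i | i in B] [set pos_bar i | i in D]).
Proof.
apply: (iffP (crossingP _ _)) => [[_ [_ [_ [_ [[/imsetP[x xA ->] /imsetP[i jB ->]
  /imsetP[y kA ->] /imsetP[j lB ->]]]]]]]|[x [y [i [j [[xA yA iD jD] [xi iy yj]]]]]]].
  by move=> /= [xi iy yj]; exists x, y, i, j; split; split=> //; lia.
exists (pos x), (pos_bar i), (pos y), (pos_bar j); split; split; rewrite ?imset_f //=;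
  lia.
Qed.

Lemma crossing_bar_pos B D : reflect
  (exists x y i j : 'I_n, [/\ x \in B, y \in B, i \in D & j \in D] /\
     [/\ i < x, x <= j & j < y]%N)
  (crossing [set pos_bar i | i in D] [set pos i | i in B]).
Proof.
apply: (iffP (crossingP _ _)) => [[_ [_ [_ [_ [[/imsetP[i xA ->] /imsetP[x jB ->]
  /imsetP[j kA ->] /imsetP[y lB ->]]]]]]]|[x [y [i [j [[xA yA iD jD] [xi iy yj]]]]]]].
  by move=> /= [xi iy yj]; exists x, y, i, j; split; split=> //; lia.
exists (pos_bar i), (pos x), (pos_bar j), (pos y); split; split; rewrite ?imset_f //=;
  lia.
Qed.

(* i' and j' lie in the same block of the complement when they are separated
   from each other by no block of P, that is, when no two points of a block are
   separated by exactly one of i', j'. *)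
Definition separation P (i : 'I_n) : {ffun 'I_n * 'I_n -> bool} :=
  [ffun xy => (finset.pblock P xy.1 == finset.pblock P xy.2) &&
              ((xy.1 <= i) (+) (xy.2 <= i))%N].

Definition kreweras_part P : {set {set 'I_n}} :=
  preim_partition (separation P) [set: 'I_n].

(** The indices [i] separating two given points of a block form an interval. Its convexity excludes
    crossings within the complement. Conversely, if [i] and [j] differ in separating [x] from [y], a
    block containing [i'] and [j'] crosses the block of [x] and [y], whence maximality. *)
Lemma kreweras_partP P : P \in NC n -> is_kreweras P (kreweras_part P).
Proof.
move=> PNC; have := PNC; rewrite -ncpartT => /andP[pP cP].
have [s ne c u] := partP _ _ pP.
have tP : finset.trivIset P by case/and3P: pP.
set K := kreweras_part P.
have pK : partition K [set: 'I_n] := preim_partitionP _ _.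
have [sK neK cK uK] := partP _ _ pK.
have KE D i j : D \in K -> i \in D -> (j \in D) = (separation P i == separation P j).
  move=> DK iD; rewrite -(def_pblock _ DK iD); last by case/and3P: pK.
  by rewrite pblock_equivalence_partition ?inE // => x y z _ _ _ /=;
     split=> // /eqP ->.
have sepE B x y i : B \in P -> x \in B -> y \in B ->
    separation P i (x, y) = ((x <= i) (+) (y <= i))%N.
  by move=> BP xB yB; rewrite ffunE /= !(def_pblock tP BP) // eqxx.
have KNC : K \in NC n.
  rewrite -ncpartT /ncpart pK; apply/uncrossedP => A B AK BK.
  move=> /crossingP[i [j [k [l [[iA jB kA lB] [ij jk kl]]]]]].
  move: kA; rewrite (KE A i k) // => /eqP/ffunP ik.
  move: lB; rewrite (KE B j l) // => /eqP/ffunP jl.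
  apply: (uK A B j) => //; rewrite (KE A i) //; apply/eqP/ffunP => -[x y].
  have mono z m1 m2 : (m1 < m2)%N -> (z <= m1)%N ==> (z <= m2)%N.
    by move=> m12; apply/implyP => /leq_trans; apply; apply: ltnW.
  have := ik (x, y); have := jl (x, y); rewrite !ffunE /=.
  case: eqP => //= _; move: (mono x _ _ ij) (mono x _ _ jk) (mono x _ _ kl).
  move: (mono y _ _ ij) (mono y _ _ jk) (mono y _ _ kl).
  by do 8!case: (_ <= _)%N.
apply/and3P; split=> //.
  apply/(interleave_NC PNC KNC) => B D BP DK; split; apply/negP.
    move=> /crossing_pos_bar[x [y [i [j [[xB yB iD jD] [xi iy yj]]]]]].
    move: jD; rewrite (KE D i j) // => /eqP/ffunP /(_ (x, y)).
    rewrite !(sepE B) // xi yj (leqNgt y i) iy.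
    by rewrite (leq_trans xi (ltnW (leq_trans iy yj))).
  move=> /crossing_bar_pos[x [y [i [j [[xB yB iD jD] [xi iy yj]]]]]].
  move: jD; rewrite (KE D i j) // => /eqP/ffunP /(_ (x, y)).
  rewrite !(sepE B) // iy (leqNgt x i) xi (leqNgt y j) yj (leqNgt y i).
  by rewrite (ltn_trans xi (leq_ltn_trans iy yj)).
apply/forall_inP => Q QNC; apply/implyP => /(interleave_NC PNC QNC) cr.
have := QNC; rewrite -ncpartT => /andP[/partP[sQ neQ _ _] _].
apply/refinesP => E EQ; have [i iE] := neQ E EQ.
have [|D DK iD] := cK i; first by rewrite inE.
exists D => //; apply/subsetP => j jE; rewrite (KE D i) //.
apply/eqP/ffunP => -[x y]; rewrite !ffunE /=.
case: eqP => //= xy; apply/eqP; apply: contraT => neq.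
have [|B BP xB] := c x; first by rewrite inE.
have yB : y \in B.
  by rewrite -(def_pblock tP BP xB) xy mem_pblock (eqP (proj1 (andP pP))) inE.
have [/crossing_pos_bar n1 /crossing_bar_pos n2] := cr B E BP EQ.
have noc (a b k l : 'I_n) : a \in B -> b \in B -> k \in E -> l \in E ->
    [&& a <= k, ~~ (b <= k) & ~~ (a <= l) || (b <= l)]%N = false.
  move=> aB bB kE lE; apply/negP; rewrite -!ltnNge => /and3P[ak kb /orP[la|bl]].
    by case: n2; exists a, b, l, k.
  by case: n1; exists a, b, k, l.
move: neq (noc x y i j xB yB iE jE) (noc y x i j yB xB iE jE).
move: (noc x y j i xB yB jE iE) (noc y x j i yB xB jE iE).
by do 4!case: (_ <= _)%N.
Qed.

Lemma krewerasP P : P \in NC n -> is_kreweras P (kreweras P).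
Proof.
move=> PNC; rewrite /kreweras; case: pickP => [//|/(_ (kreweras_part P))].
by rewrite kreweras_partP.
Qed.

Lemma kreweras_NC P : P \in NC n -> kreweras P \in NC n.
Proof. by move=> /krewerasP/and3P[]. Qed.

(** Crossings persist when blocks grow, so compatibility with [P] is inherited by everything below
    the complement. This replaces the complement by a symmetric condition on the pair [(P, Q)]. *)
Lemma refines_kreweras P Q : P \in NC n -> Q \in NC n ->
  refines Q (kreweras P) = (interleave P Q \in NC n.*2).
Proof.
move=> PNC QNC; have /and3P[KNC KI /forall_inP Kmax] := krewerasP PNC.
apply/refinesP/idP => [ref|]; last by have /implyP/[apply]/refinesP := Kmax Q QNC.
apply/(interleave_NC PNC QNC) => B D BP /ref[E EK DE].
have [c1 c2] := interleave_NC PNC KNC KI B E BP EK.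
by split; [apply: contra c1|apply: contra c2] => cr;
  apply: crossingS cr => //; apply: imsetS.
Qed.

End Kreweras.

(** * Boxed convolution as moments of alternating words *)

Section BoxedWords.
Variable C : numClosedFieldType.
Implicit Types f g beta : nat -> C.

Lemma NC_moment (I : Type) (kappa : seq I -> C) n (x : 'I_n -> I) :
  \sum_(P in NC n) \prod_(B in P) kappa [seq x i | i <- enum B] =
  moment kappa [seq x i | i <- enum 'I_n].
Proof.
transitivity (moment kappa [seq x i | i <- enum [set: 'I_n]]).
  by rewrite -ncsum_moment; apply: eq_bigl => P; rewrite ncpartT.
by congr (moment _ (map _ _)); apply: eq_enum => i; rewrite inE.
Qed.

Definition size_cumulants f (u : seq unit) : C := f (size u).

Lemma ncsum_card f n (D : {set 'I_n}) :
  ncsum (fun B => f #|B|) D = moment (size_cumulants f) (nseq #|D| tt).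
Proof.
have -> : nseq #|D| tt = [seq tt | i <- enum D].
  by rewrite cardE; elim: (enum D) => //= _ s ->.
rewrite -ncsum_moment /ncsum; apply: eq_bigr => P _; apply: eq_bigr => B _.
by rewrite /size_cumulants size_map -cardE.
Qed.

Lemma moments_of_cumulantsE f m :
  moments_of_cumulants f m = moment (size_cumulants f) (nseq m tt).
Proof.
rewrite -[in RHS](card_ord m) -cardsT -ncsum_card.
by apply: eq_bigl => P; rewrite ncpartT.
Qed.

(** The joint cumulants of two free variables with cumulants [f] and [beta]: the mixed ones
    vanish. *)
Definition pair_cumulants f beta (u : seq bool) : C :=
  if all negb u then f (size u) else if all id u then beta (size u) else 0.

Let homog n (P : {set {set 'I_(n.*2)}}) : bool :=
  [forall B in P, (B \subset evenB n) || (B \subset oddB n)].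

Let parity N (i : 'I_N) : bool := odd i.

Lemma even_setP n (B : {set 'I_(n.*2)}) :
  (B \subset evenB n) = all negb [seq parity i | i <- enum B].
Proof.
rewrite all_map; apply/fintype.subsetP/allP => [s i|s i iB].
  by rewrite mem_enum => /s /imsetP[j _ ->]; rewrite /= /parity odd_double.
have := s i; rewrite mem_enum => /(_ iB) /= ni.
have : i \in evenB n :|: oddB n by rewrite even_odd_cover inE.
case/setUP => // /imsetP[j _ ij]; move: ni.
by rewrite ij /parity /= odd_double.
Qed.

Lemma odd_setP n (B : {set 'I_(n.*2)}) :
  (B \subset oddB n) = all id [seq parity i | i <- enum B].
Proof.
rewrite all_map; apply/fintype.subsetP/allP => [s i|s i iB].
  by rewrite mem_enum => /s /imsetP[j _ ->]; rewrite /= /parity /= odd_double.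
have := s i; rewrite mem_enum => /(_ iB) /= ni.
have : i \in evenB n :|: oddB n by rewrite even_odd_cover inE.
case/setUP => // /imsetP[j _ ij]; move: ni.
by rewrite ij /parity /= odd_double.
Qed.

Lemma homog_NC n (S : {set {set 'I_(n.*2)}}) : S \in NC n.*2 -> homog S ->
  [/\ preim_blocks (@pos n) S \in NC n, preim_blocks (@pos_bar n) S \in NC n &
      interleave (preim_blocks (@pos n) S) (preim_blocks (@pos_bar n) S) = S].
Proof.
move=> SNC /forall_inP hom; have := SNC; rewrite -ncpartT => /andP[/partP[_ ne _ _] _].
have posT (x : 'I_n) : pos x \in evenB n by apply: imset_f.
have barT (x : 'I_n) : pos_bar x \in oddB n by apply: imset_f.
have evT : [set pos i | i in 'I_n] = evenB n.
  by apply/setP => y; apply/imsetP/imsetP => -[i _ ->]; exists i.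
have odT : [set pos_bar i | i in 'I_n] = oddB n.
  by apply/setP => y; apply/imsetP/imsetP => -[i _ ->]; exists i.
have dis := @even_odd_disjoint n; split.
- apply: preim_blocks_NC => //; first exact: pos_mono.
  move=> B x BS xB; rewrite evT; have /orP[//|/fintype.subsetP sB] := hom B BS.
  by have := disjointN dis (posT x) (sB _ xB).
- apply: preim_blocks_NC => //; first exact: pos_bar_mono.
  move=> B x BS xB; rewrite odT; have /orP[/fintype.subsetP sB|//] := hom B BS.
  by have := disjointN dis (sB _ xB) (barT x).
have imE (f : 'I_n -> 'I_(n.*2)) (B : {set 'I_(n.*2)}) :
    B \subset [set f i | i in 'I_n] ->
    B = [set f i | i in f @^-1: B].
  move=> /fintype.subsetP sB; apply/setP => y; apply/idP/imsetP => [yB|[x]].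
    by have /imsetP[x _ yx] := sB y yB; exists x; rewrite // inE -yx.
  by rewrite inE => fx ->.
apply/setP => B; rewrite inE; apply/orP/idP => [|BS].
  by case=> /imsetP[A]; rewrite inE => AS ->.
have /orP[] := hom B BS; rewrite -?evT -?odT => /imE BE; [left|right];
  by apply/imsetP; eexists; last exact: BE; rewrite inE -BE.
Qed.

Lemma interleave_preim n (P Q : {set {set 'I_n}}) : P \in NC n -> Q \in NC n ->
  [/\ homog (interleave P Q), preim_blocks (@pos n) (interleave P Q) = P &
      preim_blocks (@pos_bar n) (interleave P Q) = Q].
Proof.
rewrite -!ncpartT => /andP[/partP[_ neP _ _] _] /andP[/partP[_ neQ _ _] _].
split.
- apply/forall_inP => B; rewrite inE => /orP[] /imsetP[A _ ->];
  [apply/orP; left|apply/orP; right]; exact/imsetS/subsetT.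
- apply/setP => B; rewrite !inE; apply/orP/idP => [[]/imsetP[A AP]|BP].
  + by move=> /(imset_inj (mono_ord_inj (@pos_mono n))) ->.
  + move=> /esym E; have [x xA] := neQ A AP.
    have : pos_bar x \in [set pos i | i in B] by rewrite -E imset_f.
    by move=> /imsetP[y _ /esym/pos_neq_bar].
  + by left; apply/imsetP; exists B.
- apply/setP => B; rewrite !inE; apply/orP/idP => [[]/imsetP[A AP]|BP].
  + move=> /esym E; have [x xA] := neP A AP.
    have : pos x \in [set pos_bar i | i in B] by rewrite -E imset_f.
    by move=> /imsetP[y _ /pos_neq_bar].
  + by move=> /(imset_inj (mono_ord_inj (@pos_bar_mono n))) ->.
  + by right; apply/imsetP; exists B.
Qed.

(** Expanding [g] into [beta] turns the product over the complement of [P] into a sum over the [Q]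
    refining it. The pairs [(P, Q)] are then exactly the noncrossing partitions of [2m] points
    without mixed blocks, so this is the moment of [(xy)^m] for free [x], [y]. *)
Lemma boxed_conv_moment f g beta m : g =+ moments_of_cumulants beta ->
  boxed_conv f g m = moment (pair_cumulants f beta) (map odd (iota 0 m.*2)).
Proof.
move=> gE; rewrite -val_enum_ord -map_comp.
rewrite -(NC_moment (pair_cumulants f beta) (@parity m.*2)).
transitivity (\sum_(P in NC m) \sum_(Q in NC m | interleave P Q \in NC m.*2)
   (\prod_(B in P) f #|B|) * (\prod_(B in Q) beta #|B|)).
  rewrite /boxed_conv; apply: eq_bigr => P PNC; rewrite -big_distrr /=.
  congr (_ * _); have KNC := kreweras_NC PNC.
  have := KNC; rewrite -ncpartT => /andP[pK cK].
  have [/eqP cov tK nK] := and3P pK; have /partP[_ neK _ _] := pK.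
  transitivity (\prod_(D in kreweras P) ncsum (fun B => beta #|B|) D).
    apply: eq_bigr => D DK; rewrite ncsum_card -moments_of_cumulantsE gE //.
    by have [x xD] := neK D DK; apply/card_gt0P; exists x.
  rewrite -(ncsum_refine _ cK tK nK) cov; apply: eq_bigl => Q.
  rewrite ncpartT; case QNC: (Q \in NC m) => //=; exact: refines_kreweras.
rewrite (pair_big_dep (mem (NC m))
  (fun P Q => (Q \in NC m) && (interleave P Q \in NC m.*2))) /=.
(* Partitions with a block of mixed parity carry a vanishing cumulant. *)
rewrite (bigID (@homog m)) /= [X in _ = _ + X]big1 ?addr0; last first.
  move=> S /andP[_ /forall_inPn [B BS]]; rewrite negb_or => /andP[ne no].
  rewrite (bigD1 B BS) /= /pair_cumulants -even_setP -odd_setP.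
  by rewrite (negbTE ne) (negbTE no) mul0r.
rewrite (reindex_onto (fun p : {set {set 'I_m}} * {set {set 'I_m}} => interleave p.1 p.2)
  (fun S => (preim_blocks (@pos m) S, preim_blocks (@pos_bar m) S))) /=; last first.
  by move=> S /andP[SNC hS]; have [_ _] := homog_NC SNC hS.
apply: eq_big => [[P Q]|[P Q] /= /andP[PNC /andP[QNC INC]]] /=.
  apply/andP/andP => [[PNC /andP[QNC INC]]|[/andP[INC hI] /eqP[PE QE]]].
    by have [-> -> ->] := interleave_preim PNC QNC; rewrite INC.
  by have [PNC QNC _] := homog_NC INC hI; rewrite PE QE in PNC QNC; rewrite PNC QNC INC.
have := PNC; rewrite -ncpartT => /andP[pP _].
have := QNC; rewrite -ncpartT => /andP[pQ _].
have /partP[_ neP _ _] := pP; have /partP[_ neQ _ _] := pQ.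
rewrite (eq_bigl [predU [set [set pos i | i in B] | B : {set 'I_m} in P] &
  [set [set pos_bar i | i in B] | B : {set 'I_m} in Q]]) => [|B]; last by rewrite !inE.
rewrite bigU /=; last first.
  rewrite -setI_eq0; apply/eqP/setP => B; rewrite in_setI in_set0; apply/negP.
  move=> /andP[/imsetP[A AP ->] /imsetP[D DQ]]; apply: imset_pos_neq.
  by have [x xA] := neP A AP; apply/set0Pn; exists x.
rewrite !big_imset /=; last 2 first.
- by move=> A B _ _ /(imset_inj (mono_ord_inj (@pos_bar_mono m))).
- by move=> A B _ _ /(imset_inj (mono_ord_inj (@pos_mono m))).
congr (_ * _); apply: eq_bigr => B BP.
  rewrite /pair_cumulants -even_setP imsetS ?subsetT // size_map -cardE.
  by rewrite card_imset //; apply: mono_ord_inj (@pos_mono m).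
rewrite /pair_cumulants -even_setP -odd_setP (imsetS _ (subsetT B)).
rewrite size_map -cardE card_imset; last exact: mono_ord_inj (@pos_bar_mono m).
case: ifP => // /fintype.subsetP sB; have [x xB] := neQ B BP.
have := sB (pos_bar x); rewrite imset_f // => /(_ isT).
by move=> /imsetP[y _ /esym/pos_neq_bar].
Qed.

End BoxedWords.

From mathcomp Require Import all_classical all_reals.
From mathcomp Require Import complex.

Local Open Scope classical_set_scope.

(** * Formal power series *)

Record fps (K : fieldType) := Fps { coef : nat -> K }.

HB.instance Definition _ (K : fieldType) := gen_eqMixin (fps K).
HB.instance Definition _ (K : fieldType) := gen_choiceMixin (fps K).

Section SeriesRing.
Variable K : fieldType.
Implicit Types f g h : fps K.

Lemma fpsP f g : (forall n, coef f n = coef g n) -> f = g.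
Proof. by case: f g => [f] [g] /= fg; congr Fps; apply/funext. Qed.

Definition fps_zero : fps K := Fps (fun=> 0).
Definition fps_opp f : fps K := Fps (fun n => - coef f n).
Definition fps_add f g : fps K := Fps (fun n => coef f n + coef g n).

Lemma fps_addA : associative fps_add.
Proof. by move=> f g h; apply: fpsP => n /=; rewrite addrA. Qed.
Lemma fps_addC : commutative fps_add.
Proof. by move=> f g; apply: fpsP => n /=; rewrite addrC. Qed.
Lemma fps_add0 : left_id fps_zero fps_add.
Proof. by move=> f; apply: fpsP => n /=; rewrite add0r. Qed.
Lemma fps_addN : left_inverse fps_zero fps_opp fps_add.
Proof. by move=> f; apply: fpsP => n /=; rewrite addNr. Qed.

HB.instance Definition _ :=
  GRing.isZmodule.Build (fps K) fps_addA fps_addC fps_add0 fps_addN.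

Definition fps_one : fps K := Fps (fun n => (n == 0%N)%:R).
Definition fps_mul f g : fps K :=
  Fps (fun n => \sum_(i < n.+1) coef f i * coef g (n - i)).

(** A coefficient of a product sees only truncations, so the ring laws for multiplication come from
    those of polynomials. *)
Definition fps_trunc N f : {poly K} := \poly_(i < N) coef f i.

Lemma coef_fps_trunc N f i : (i < N)%N -> (fps_trunc N f)`_i = coef f i.
Proof. by move=> iN; rewrite coef_poly iN. Qed.

Lemma coef_fps_mul N f g n : (n < N)%N ->
  coef (fps_mul f g) n = (fps_trunc N f * fps_trunc N g)`_n.
Proof.
move=> nN; rewrite coefM; apply: eq_bigr => i _.
rewrite !coef_fps_trunc //; first exact: leq_ltn_trans (leq_subr _ _) nN.
by apply: leq_ltn_trans nN; rewrite -ltnS.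
Qed.

Lemma fps_mulC : commutative fps_mul.
Proof.
by move=> f g; apply: fpsP => n; rewrite !(@coef_fps_mul n.+1) // mulrC.
Qed.

Lemma fps_mulA : associative fps_mul.
Proof.
move=> f g h; apply: fpsP => n.
have Etr (u v : fps K) i : (i < n.+1)%N ->
  coef (fps_mul u v) i = (fps_trunc n.+1 u * fps_trunc n.+1 v)`_i.
  exact: coef_fps_mul.
transitivity ((fps_trunc n.+1 f * (fps_trunc n.+1 g * fps_trunc n.+1 h))`_n).
  rewrite /= coefM; apply: eq_bigr => i _.
  by rewrite coef_fps_trunc // -Etr // ltnS leq_subr.
rewrite mulrA coefM; apply: eq_bigr => i _.
by rewrite (coef_fps_trunc h) ?ltnS ?leq_subr // -Etr.
Qed.

Lemma fps_mul1 : left_id fps_one fps_mul.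
Proof.
move=> f; apply: fpsP => n /=.
by rewrite big_ord_recl /= mul1r subn0 big1 ?addr0 // => i _; rewrite mul0r.
Qed.

Lemma fps_mulDl : left_distributive fps_mul fps_add.
Proof.
move=> f g h; apply: fpsP => n /=.
by rewrite -big_split; apply: eq_bigr => i _ /=; rewrite mulrDl.
Qed.

Lemma fps_one_neq0 : fps_one != 0.
Proof.
apply/eqP => /(congr1 (fun f => coef f 0)) /= /eqP.
by rewrite oner_eq0.
Qed.

HB.instance Definition _ := GRing.Zmodule_isComNzRing.Build (fps K)
  fps_mulA fps_mulC fps_mul1 fps_mulDl fps_one_neq0.

Definition fpsC (c : K) : fps K := Fps (fun n => if n is 0 then c else 0).
Definition fpsX : fps K := Fps (fun n => (n == 1%N)%:R).
Definition shift f : fps K := Fps (fun n => coef f n.+1).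

Lemma fcoefD f g n : coef (f + g) n = coef f n + coef g n. Proof. by []. Qed.
Lemma fcoefB f g n : coef (f - g) n = coef f n - coef g n. Proof. by []. Qed.
Lemma fcoefM f g n :
  coef (f * g) n = \sum_(i < n.+1) coef f i * coef g (n - i).
Proof. by []. Qed.
Lemma fcoefM0 f g : coef (f * g) 0 = coef f 0 * coef g 0.
Proof. by rewrite fcoefM big_ord1. Qed.
Lemma fcoefCM c f n : coef (fpsC c * f) n = c * coef f n.
Proof.
by rewrite fcoefM big_ord_recl subn0 big1 ?addr0 // => i _; rewrite mul0r.
Qed.
Lemma fcoefXM0 f : coef (fpsX * f) 0 = 0.
Proof. by rewrite fcoefM0 mul0r. Qed.
Lemma fcoefXMS f n : coef (fpsX * f) n.+1 = coef f n.
Proof.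
rewrite fcoefM !big_ord_recl big1 ?addr0 => [|i _]; last by rewrite mul0r.
by rewrite mul0r add0r mul1r subSS subn0.
Qed.

Lemma fpsCD c d : fpsC (c + d) = fpsC c + fpsC d.
Proof. by apply: fpsP => -[|n] /=; rewrite ?addr0. Qed.
Lemma fpsCM c d : fpsC (c * d) = fpsC c * fpsC d.
Proof. by apply: fpsP => n; rewrite fcoefCM; case: n => //= n; rewrite mulr0. Qed.
Lemma fpsC1 : fpsC 1 = 1.
Proof. by apply: fpsP => -[]. Qed.
Lemma fpsC0 : fpsC 0 = 0.
Proof. by apply: fpsP => -[]. Qed.

Lemma shiftE f : f = fpsC (coef f 0) + fpsX * shift f.
Proof.
by apply: fpsP => -[|n]; rewrite fcoefD ?fcoefXM0 ?fcoefXMS ?addr0 ?add0r.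
Qed.
Lemma coef_CX0 c f : coef (fpsC c + fpsX * f) 0 = c.
Proof. by rewrite fcoefD fcoefXM0 addr0. Qed.
Lemma shift_CX c f : shift (fpsC c + fpsX * f) = f.
Proof. by apply: fpsP => n; rewrite [LHS]fcoefD fcoefXMS add0r. Qed.
Lemma shiftM f g :
  shift (f * g) = fpsC (coef f 0) * shift g + shift f * g.
Proof.
rewrite -[RHS](shift_CX (coef f 0 * coef g 0)); congr shift; rewrite fpsCM.
move: (shiftE f) (shiftE g); move: (coef f 0) (coef g 0) (shift f) (shift g).
by move=> f0 g0 f' g' -> ->; ring.
Qed.
Lemma fpsXI f g : fpsX * f = fpsX * g -> f = g.
Proof. by move=> fg; apply: fpsP => n; rewrite -(fcoefXMS f) fg fcoefXMS. Qed.

Definition eq_upto n f g := forall i, (i < n)%N -> coef f i = coef g i.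

Lemma eq_uptoW n f g : eq_upto n.+1 f g -> eq_upto n f g.
Proof. by move=> fg i /ltnW /fg. Qed.
Lemma eq_upto_refl n f : eq_upto n f f. Proof. by []. Qed.
Lemma eq_upto_sym n f g : eq_upto n f g -> eq_upto n g f.
Proof. by move=> fg i /fg. Qed.
Lemma eq_upto_trans n f g h : eq_upto n f g -> eq_upto n g h -> eq_upto n f h.
Proof. by move=> fg gh i ni; rewrite fg // gh. Qed.
Lemma eq_upto_fps f g : (forall n, eq_upto n f g) -> f = g.
Proof. by move=> fg; apply: fpsP => n; apply: (fg n.+1). Qed.
Lemma eq_uptoD n f f' g g' :
  eq_upto n f f' -> eq_upto n g g' -> eq_upto n (f + g) (f' + g').
Proof. by move=> ff' gg' i ni; rewrite !fcoefD ff' // gg'. Qed.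
Lemma eq_uptoM n f f' g g' :
  eq_upto n f f' -> eq_upto n g g' -> eq_upto n (f * g) (f' * g').
Proof.
move=> ff' gg' i ni; rewrite !fcoefM; apply: eq_bigr => j _.
rewrite ff' ?gg' //; first exact: leq_ltn_trans (leq_subr _ _) ni.
by apply: leq_ltn_trans ni; rewrite -ltnS.
Qed.
Lemma eq_uptoX n f g :
  eq_upto n f g -> eq_upto n.+1 (fpsX * f) (fpsX * g).
Proof. by move=> fg [|i] ni; rewrite ?fcoefXM0 // !fcoefXMS fg. Qed.

Lemma fps_inverse f : coef f 0 != 0 -> exists g, f * g = 1.
Proof.
move=> f0.
(* [s n] lists the first [n] coefficients of the inverse, the latest first; [n == 1] thus marks the
   constant one. *)
pose s := fix s n : seq K := if n is n'.+1 then let r := s n' in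
  (((n == 1%N)%:R - \sum_(i < n') coef f i.+1 * nth 0 r i) / coef f 0) :: r
  else [::].
have size_s n : size (s n) = n by elim: n => //= n ->.
exists (Fps (fun n => head 0 (s n.+1))); apply: fpsP => n.
have nth_s m i : (i < m)%N -> nth 0 (s m) i = head 0 (s (m - i)%N).
  elim: m i => // m IH [|i] im; first by rewrite subn0.
  by rewrite [LHS](IH i im) subSS.
rewrite fcoefM big_ord_recl subn0 [coef (Fps _) n]/=.
rewrite mulrCA divff // mulr1.
under [X in _ - X]eq_bigr => i _ do rewrite nth_s //.
rewrite -[RHS](subrK (\sum_(i < n) coef f i.+1 * head 0 (s (n - i)%N))).
by congr (_ + _); apply: eq_bigr => i _; rewrite -(subnSK (ltn_ord i)).
Qed.

Lemma fps_mulI f g h : coef f 0 != 0 -> f * g = f * h -> g = h.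
Proof.
move=> /fps_inverse [f' ff'] fgh.
by rewrite -[g]mul1r -[h]mul1r -ff' mulrC mulrA -(mulrC f) fgh; ring.
Qed.

End SeriesRing.

Arguments fpsX {K}.

(** * Composition *)

Section Composition.
Variable K : fieldType.
Implicit Types f g u v w : fps K.

Fixpoint comp_approx n f u : fps K :=
  if n is n'.+1 then fpsC (coef f 0) + fpsX * (u * comp_approx n' (shift f) u)
  else 0.

(* The series f(z u(z)); the factor z makes the substitution always legal. *)
Definition comp f u : fps K :=
  Fps (fun n => coef (comp_approx n.+1 f u) n).

Local Notation "f @z u" := (comp f u) (at level 30).

Lemma comp_approx_stable n m f u : (n <= m)%N ->
  eq_upto n (comp_approx n f u) (comp_approx m f u).
Proof.
elim: n m f => [|n IH] [|m] f //= nm.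
by apply: eq_uptoD => //; apply/eq_uptoX/eq_uptoM => //; apply: IH.
Qed.

Lemma comp_approxP n f u : eq_upto n (f @z u) (comp_approx n f u).
Proof. by move=> i ni; apply: comp_approx_stable ni i (leqnn _). Qed.

Lemma compE f u : f @z u = fpsC (coef f 0) + fpsX * (u * (shift f @z u)).
Proof.
apply: eq_upto_fps => -[//|n].
apply: eq_upto_trans (comp_approxP _ _) _ => /=.
by apply/eq_uptoD/eq_uptoX/eq_uptoM => //; apply/eq_upto_sym/comp_approxP.
Qed.

(** The factor [z] gains one degree of agreement. This contraction is behind [fixpoint_unique] and
    every uniqueness argument below. *)
Lemma comp_contract n f u v : eq_upto n u v -> eq_upto n.+1 (f @z u) (f @z v).
Proof.
elim: n f => [|n IH] f uv; rewrite compE (compE f v);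
  apply/eq_uptoD/eq_uptoX/eq_uptoM => //.
by apply: IH; apply: eq_uptoW.
Qed.

Lemma compC c u : fpsC c @z u = fpsC c.
Proof.
have -> : fpsC c = fpsC c + fpsX * 0 by rewrite mulr0 addr0.
rewrite compE coef_CX0 shift_CX; congr (_ + _ * _).
suff -> : (0 : fps K) @z u = 0 by rewrite mulr0.
apply: eq_upto_fps; elim=> // n IH; rewrite compE fpsC0 add0r.
have -> : shift (0 : fps K) = 0 by apply: fpsP.
rewrite -[X in eq_upto _ _ X](mulr0 fpsX); apply: eq_uptoX.
rewrite -[X in eq_upto _ _ X](mulr0 u); exact: eq_uptoM.
Qed.

Lemma comp1 u : 1 @z u = 1.
Proof. by rewrite -fpsC1 compC. Qed.

Lemma compD f g u : (f + g) @z u = f @z u + g @z u.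
Proof.
apply: eq_upto_fps => n; elim: n f g => // n IH f g.
rewrite compE (compE f) (compE g) fpsCD.
have -> : shift (f + g) = shift f + shift g by apply: fpsP.
rewrite (_ : _ + _ + (_ + _) = fpsC (coef f 0) + fpsC (coef g 0) +
  fpsX * (u * (shift f @z u + shift g @z u))); last by ring.
apply: eq_uptoD => //; apply: eq_uptoX.
by do 2!apply: eq_uptoM => //.
Qed.

Lemma compM f g u : (f * g) @z u = (f @z u) * (g @z u).
Proof.
apply: eq_upto_fps => n; elim: n f g => // n IH f g.
rewrite compE fcoefM0 fpsCM shiftM compD.
rewrite (_ : f @z u * _ = fpsC (coef f 0) * fpsC (coef g 0) + fpsX *
  (u * (fpsC (coef f 0) * (shift g @z u) + (shift f @z u) * (g @z u)))).
  apply/eq_uptoD/eq_uptoX/eq_uptoM/eq_uptoD => //.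
  by rewrite -{2}(compC (coef f 0) u).
move: (compE f u) (compE g u); move: (f @z u) (g @z u) (shift f @z u).
by move=> F G F' -> ->; ring.
Qed.

Lemma compCM c f u : (fpsC c * f) @z u = fpsC c * (f @z u).
Proof. by rewrite compM compC. Qed.

Lemma compX u : fpsX @z u = fpsX * u.
Proof.
have XE : fpsX = fpsC 0 + fpsX * 1 :> fps K by rewrite fpsC0 add0r mulr1.
by rewrite {1}XE compE coef_CX0 shift_CX comp1 fpsC0 add0r mulr1.
Qed.

Lemma compXM f u : (fpsX * f) @z u = fpsX * (u * (f @z u)).
Proof. by rewrite compM compX mulrA. Qed.

Lemma comp_id f : f @z 1 = f.
Proof.
apply: eq_upto_fps => n; elim: n f => // n IH f.
rewrite compE mul1r [X in eq_upto _ _ X](shiftE f).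
by apply: eq_uptoD => //; apply: eq_uptoX.
Qed.

Lemma compA f u v : (f @z u) @z v = f @z (v * (u @z v)).
Proof.
apply: eq_upto_fps => n; elim: n f => // n IH f.
rewrite (compE f u) (compE f (_ * _)) compD compC compXM compM -(mulrA v).
apply: eq_uptoD => //; apply: eq_uptoX.
by do 2!apply: eq_uptoM => //.
Qed.

Lemma coef_comp0 f u : coef (f @z u) 0 = coef f 0.
Proof. by rewrite compE coef_CX0. Qed.

Lemma comp_inj u f g : coef u 0 != 0 -> f @z u = g @z u -> f = g.
Proof.
move=> u0 fg; apply: eq_upto_fps => n.
elim: n f g fg => // n IH f g fg.
have fg0 : coef f 0 = coef g 0 by rewrite -(coef_comp0 f u) fg coef_comp0.
move: fg; rewrite compE (compE g) fg0 => /addrI /fpsXI.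
by move=> /(fps_mulI u0) /IH fg [|i] // /fg.
Qed.

Lemma comp_surj u h : coef u 0 != 0 -> exists f, f @z u = h.
Proof.
move=> u0; have [v uv] := fps_inverse u0.
(* f_n is the constant term of the n-fold iterate of h |-> (h - h_0)/(z u) *)
pose next g := v * shift g.
pose f g := Fps (fun n => coef (iter n next g) 0).
have shift_f g : shift (f g) = f (next g).
  by apply: fpsP => n; congr (coef _ 0); apply: iterSr.
exists (f h); apply: eq_upto_fps => n; elim: n h => // n IH h.
rewrite compE shift_f [X in eq_upto _ _ X](shiftE h) /=; apply: eq_uptoD => //.
apply: eq_uptoX; apply: eq_upto_trans (eq_uptoM (eq_upto_refl _) (IH _)) _.
by rewrite /next mulrA uv mul1r.
Qed.

(** Unrolling gives the sum of the [a_k (z w)^k y]. In the applications [k] counts the letters, or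
    pairs of letters, already read, [w] collects the gaps crossed at each stage and [y] the last
    one. *)
Lemma comp_geom (a : nat -> K) (T : nat -> fps K) w y :
  (forall k, T k = fpsC (a k) * y + fpsX * w * T k.+1) ->
  T 0 = (Fps a @z w) * y.
Proof.
move=> TE; apply: eq_upto_fps => n; elim: n a T TE => // n IH a T TE.
rewrite TE compE /= mulrDl -!mulrA.
apply/eq_uptoD/eq_uptoX/eq_uptoM => //.
exact: (IH (fun k => a k.+1) (fun k => T k.+1)).
Qed.

Lemma fixpoint_unique (Phi : fps K -> fps K) f g :
  (forall n u v, eq_upto n u v -> eq_upto n.+1 (Phi u) (Phi v)) ->
  f = Phi f -> g = Phi g -> f = g.
Proof.
move=> contract fE gE; apply: eq_upto_fps; elim=> // n IH.
by rewrite fE gE; apply: contract.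
Qed.

End Composition.

Notation "f @z u" := (comp f u) (at level 30) : ring_scope.

(** * Cumulant series *)

Section ScanTheory.
Variables (R : comNzRingType) (I : Type) (kappa mm : seq I -> R).

(** The branches of [scan] are grouped by the position [j] of the next letter of the block; the
    isolated term is the case where the block ends. [x0] is only the default of [nth]. *)
Lemma scan_expand (x0 : I) u v w :
  scan kappa mm u v w = kappa u * mm (v ++ w) +
    \sum_(j < size w) mm (v ++ take j w) *
       scan kappa mm (rcons u (nth x0 w j)) [::] (drop j.+1 w).
Proof.
elim: w v => [|i w IH] v /=; first by rewrite cats0 big_ord0 addr0.
rewrite IH big_ord_recl /= cats0 drop0 cat_rcons addrCA; congr (_ + (_ + _)).
by apply: eq_bigr => j _; rewrite /= cat_rcons.
Qed.

Lemma scan_dead u v w :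
  (forall s, kappa (u ++ s) = 0) -> scan kappa mm u v w = 0.
Proof.
elim: w u v => [|i w IH] u v /= dead; first by rewrite -[u]cats0 dead mul0r.
rewrite !IH ?mulr0 ?addr0 // => s; by rewrite cat_rcons dead.
Qed.

End ScanTheory.

Lemma sum_odd_double (V : nmodType) (F : nat -> V) k :
  \sum_(j < k.*2) (if odd j then F j else 0) = \sum_(r < k) F r.*2.+1.
Proof.
elim: k => [|k IH]; first by rewrite !big_ord0.
by rewrite doubleS !big_ord_recr /= IH odd_double /= addr0.
Qed.

Lemma sum_odd_doubleS (V : nmodType) (F : nat -> V) k :
  \sum_(j < k.*2.+1) (if odd j then F j else 0) = \sum_(r < k) F r.*2.+1.
Proof. by rewrite big_ord_recr /= odd_double addr0 sum_odd_double. Qed.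

Lemma sum_even_double (V : nmodType) (F : nat -> V) k :
  \sum_(j < k.*2) (if odd j then 0 else F j) = \sum_(r < k) F r.*2.
Proof.
elim: k => [|k IH]; first by rewrite !big_ord0.
by rewrite doubleS !big_ord_recr /= IH odd_double /= addr0.
Qed.

Lemma sum_even_doubleS (V : nmodType) (F : nat -> V) k :
  \sum_(j < k.*2.+1) (if odd j then 0 else F j) = \sum_(r < k.+1) F r.*2.
Proof. by rewrite !big_ord_recr /= odd_double sum_even_double. Qed.

Lemma fcoefXMM (K : fieldType) (f g : fps K) n :
  coef (fpsX * f * g) n = \sum_(j < n) coef f j * coef g (n - j.+1).
Proof.
by rewrite -mulrA; case: n => [|n]; rewrite ?fcoefXM0 ?big_ord0 // fcoefXMS.
Qed.

Fixpoint alternating b n : seq bool :=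
  if n is n'.+1 then b :: alternating (~~ b) n' else [::].

Lemma size_alternating b n : size (alternating b n) = n.
Proof. by elim: n b => //= n IH b; rewrite IH. Qed.

Lemma nth_alternating b n j : (j < n)%N ->
  nth false (alternating b n) j = b (+) odd j.
Proof.
elim: n b j => // n IH b [|j] /=; first by rewrite addbF.
by move=> jn; rewrite IH // addNb addbN.
Qed.

Lemma take_alternating b n j : (j <= n)%N ->
  take j (alternating b n) = alternating b j.
Proof. by elim: n b j => [|n IH] b [|j] //= jn; rewrite IH. Qed.

Lemma drop_alternating b n j :
  drop j (alternating b n) = alternating (b (+) odd j) (n - j).
Proof.
elim: n b j => [|n IH] b [|j] //=; first by rewrite addbF.
by rewrite IH subSS addNb addbN.
Qed.

Lemma map_odd_iota n : map odd (iota 0 n) = alternating false n.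
Proof.
suff odd_iota m : map odd (iota m n) = alternating (odd m) n by apply: odd_iota.
by elim: n m => //= n IH m; rewrite IH.
Qed.

Section CumulantSeries.
Variable C : numClosedFieldType.
Implicit Types (f g kappa rho mu : nat -> C) (x y N : fps C).

(** The series [f(z) / z]: it forgets the meaningless value at 0, and [f(z u)] becomes [z u] times
    [hat f @z u]. *)
Definition hat f : fps C := Fps (fun k => f k.+1).

Lemma hatP f g : hat f = hat g <-> f =+ g.
Proof.
split=> [fg [//|k] _|fg]; first exact: (congr1 (fun h => coef h k) fg).
by apply: fpsP => k; apply: fg.
Qed.

Lemma hat_coef (h : fps C) : hat (fun k => coef h k.-1) = h.
Proof. by apply: fpsP. Qed.

Lemma hatZ (a : C) f : hat (fun k => a * f k) = fpsC a * hat f.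
Proof. by apply: fpsP => k; rewrite fcoefCM. Qed.

Definition mom_series f : fps C := Fps (moments_of_cumulants f).

Lemma coef_mom_series0 f : coef (mom_series f) 0 = 1.
Proof. by rewrite /= moments_of_cumulantsE moment_nil. Qed.

Lemma shift_mom_series f : shift (mom_series f) = hat (moments_of_cumulants f).
Proof. by []. Qed.

(** This is [N = 1 + f(z N)]: each letter of the first block is followed by a gap, and the gaps are
    summed independently. [T s] below collects the states in which that block has [s.+1] letters. *)
Lemma mom_seriesE f :
  mom_series f = 1 + fpsX * (mom_series f * (hat f @z mom_series f)).
Proof.
set N := mom_series f.
pose m := moment (size_cumulants f).
have NE n : coef N n = m (nseq n tt) by rewrite /= moments_of_cumulantsE.
have kE s : size_cumulants f (nseq s tt) = f s.
  by rewrite /size_cumulants size_nseq.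
have unit_seqE (u : seq unit) : u = nseq (size u) tt.
  by elim: u => //= -[] u {1}->.
pose T s := Fps (fun n => scan (size_cumulants f) m (nseq s.+1 tt) [::] (nseq n tt)).
have TE s : T s = fpsC (f s.+1) * N + fpsX * N * T s.+1.
  apply: fpsP => n; rewrite fcoefD fcoefCM fcoefXMM.
  rewrite -[coef (T s) n]/(scan _ m (nseq s.+1 tt) [::] (nseq n tt)).
  rewrite (scan_expand _ _ tt) NE kE size_nseq; congr (_ + _); apply: eq_bigr => j _.
  rewrite NE take_nseq 1?ltnW // drop_nseq.
  by rewrite [rcons _ _]unit_seqE size_rcons size_nseq.
have NT : N = 1 + fpsX * T 0.
  apply: fpsP => -[|n]; first by rewrite fcoefD fcoefXM0 addr0 coef_mom_series0.
  by rewrite fcoefD fcoefXMS add0r NE /= -moment_cons.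
by rewrite {1}NT (comp_geom TE) [X in _ + fpsX * X]mulrC.
Qed.

End CumulantSeries.

Section MomentSeries.
Variable C : numClosedFieldType.
Implicit Types (f g kappa rho mu : nat -> C) (x y N : fps C).

Lemma mom_series_unique f N :
  N = 1 + fpsX * (N * (hat f @z N)) -> mom_series f = N.
Proof.
apply: (@fixpoint_unique _ (fun N => 1 + fpsX * (N * (hat f @z N)))).
  move=> n u v uv; apply: eq_uptoD => //; apply/eq_uptoX/eq_uptoM => //.
  exact/eq_uptoW/comp_contract.
exact: mom_seriesE.
Qed.

(** Once [N = 1 + z hat mu] is prescribed, [mom_seriesE] only asks that [hat f @z N] be
    [hat mu / N], which [comp_surj] solves. *)
Lemma moments_surj mu : exists f, mu =+ moments_of_cumulants f.
Proof.
pose N := 1 + fpsX * hat mu.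
have N0 : coef N 0 = 1 by rewrite fcoefD fcoefXM0 addr0.
have [|N' NN'] := @fps_inverse _ N; first by rewrite N0 oner_eq0.
have [|h hE] := @comp_surj _ N (N' * hat mu); first by rewrite N0 oner_eq0.
exists (fun k => coef h k.-1); apply/hatP; rewrite -shift_mom_series.
rewrite (@mom_series_unique _ N); last by rewrite hat_coef hE (mulrA N) NN' mul1r.
by rewrite /N -fpsC1 shift_CX.
Qed.

Lemma moments_ext f g : f =+ g -> moments_of_cumulants f = moments_of_cumulants g.
Proof.
move=> /hatP fg; suff /(congr1 (@coef C)) : mom_series f = mom_series g by [].
by apply: mom_series_unique; rewrite fg -mom_seriesE.
Qed.

Lemma moments_inj f g :
  moments_of_cumulants f =+ moments_of_cumulants g -> f =+ g.
Proof.
move=> /hatP; rewrite -!shift_mom_series => sfg.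
have fg : mom_series f = mom_series g.
  by rewrite (shiftE (mom_series f)) (shiftE (mom_series g)) sfg !coef_mom_series0.
have N0 : coef (mom_series g) 0 != 0 by rewrite coef_mom_series0 oner_eq0.
apply/hatP/(comp_inj N0); apply: (fps_mulI N0).
have := mom_seriesE f; rewrite fg {1}(mom_seriesE g).
by move=> /addrI /fpsXI.
Qed.

(** * Functional equations of boxed convolution *)

Section PairSeries.
Variables f beta : nat -> C.
Let kap := pair_cumulants f beta.
Let m := moment kap.
Let fam (b : bool) := if b then beta else f.
Let O b := Fps (fun k => m (alternating b k.*2.+1)).
Let H b := Fps (fun k => m (alternating b k.*2)).
(** The first block has read [s.+1] letters [b] and [n] letters remain. Mixed cumulants vanish, so
    its next letter is again [b] and the gap before it has odd length. *)
Let e b s n := scan kap m (nseq s.+1 b) [::] (alternating (~~ b) n).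

Let kap_nseq b s : kap (nseq s.+1 b) = fam b s.+1.
Proof. by case: b; rewrite /kap /pair_cumulants /= ?all_nseq ?orbT size_nseq. Qed.

Let kap_mixed b s t : kap (rcons (nseq s.+1 b) (~~ b) ++ t) = 0.
Proof.
by rewrite cat_rcons /kap /pair_cumulants !all_cat; case: b => /=; rewrite ?andbF.
Qed.

Let eE b s n : e b s n = fam b s.+1 * m (alternating (~~ b) n) +
  \sum_(j < n) (if odd j then m (alternating (~~ b) j) * e b s.+1 (n - j.+1) else 0).
Proof.
rewrite /e (scan_expand _ _ false) kap_nseq size_alternating; congr (_ + _).
apply: eq_bigr => j _.
rewrite nth_alternating // take_alternating 1?ltnW // drop_alternating /= addNb.
case: ifP => jo; last first.
  by rewrite addbF scan_dead ?mulr0 // => t; apply: kap_mixed.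
rewrite addbT negbK addbF /e; congr (_ * scan _ _ _ _ _).
by elim: (s) => //= k {1}<-.
Qed.

Let O_E b : O b = (hat (fam b) @z O (~~ b)) * H (~~ b).
Proof.
pose T s := Fps (fun k => e b s k.*2).
have TE s : T s = fpsC (fam b s.+1) * H (~~ b) + fpsX * O (~~ b) * T s.+1.
  apply: fpsP => k; rewrite fcoefD fcoefCM fcoefXMM [LHS]/= eE.
  rewrite (sum_odd_double (fun j => m (alternating (~~ b) j) *
                                    e b s.+1 (k.*2 - j.+1))).
  congr (_ + _); apply: eq_bigr => j _.
  by rewrite -doubleS -doubleB.
rewrite -(comp_geom TE); apply: fpsP => k.
by rewrite /= /m moment_cons.
Qed.

Let H_E b : H b = 1 + fpsX * ((hat (fam b) @z O (~~ b)) * O (~~ b)).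
Proof.
pose T s := Fps (fun k => e b s k.*2.+1).
have TE s : T s = fpsC (fam b s.+1) * O (~~ b) + fpsX * O (~~ b) * T s.+1.
  apply: fpsP => k; rewrite fcoefD fcoefCM fcoefXMM [LHS]/= eE.
  rewrite (sum_odd_doubleS (fun j => m (alternating (~~ b) j) *
                                    e b s.+1 (k.*2.+1 - j.+1))).
  congr (_ + _); apply: eq_bigr => j _.
  by rewrite -doubleS subSn ?leq_double // -doubleB.
rewrite -(comp_geom TE); apply: fpsP => -[|k].
  by rewrite fcoefD fcoefXM0 addr0.
by rewrite fcoefD fcoefXMS add0r /= /m moment_cons.
Qed.

(** The witnesses are [x = O true] and [h], the even series without its constant term, divided by
    [z]. The system closes because the even series does not depend on the first letter, as two
    computations of [Hx * Hy] show; that series is then the moment series of [beta] at [z y]. *)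
Lemma pair_series : exists x y h,
  [/\ forall k, coef h k = m (alternating false k.+1.*2), h = x * y,
      hat f @z x = y & hat (moments_of_cumulants beta) @z y = x].
Proof.
have := O_E false; have := O_E true; have := H_E false; have := H_E true.
rewrite /fam /=; set Ox := O false; set Oy := O true; set Hx := H false.
set Hy := H true => HyE HxE OyE OxE.
have HH : Hx = Hy.
  have E1 : Hx * Hy = Hy + fpsX * (Ox * Oy) by rewrite {1}HxE OxE; ring.
  have E2 : Hx * Hy = Hx + fpsX * (Ox * Oy) by rewrite {1}HyE OyE; ring.
  by apply: (addIr (fpsX * (Ox * Oy))); rewrite -E2 -E1.
exists Oy, (hat f @z Oy), (shift Hx); split=> //.
  by rewrite HxE -fpsC1 shift_CX mulrC.
set y := hat f @z Oy; set N := mom_series beta.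
have OxyE : Ox = y * Hx by rewrite HH.
have NE : N @z y = Hx.
  apply: (@fixpoint_unique _
    (fun n => 1 + fpsX * (y * n * (hat beta @z (y * n))))).
  - move=> n u v uv; apply: eq_uptoD => //; apply: eq_uptoX.
    have yuv : eq_upto n (y * u) (y * v) by apply: eq_uptoM.
    exact/eq_uptoM/eq_uptoW/comp_contract.
  - by rewrite {1}/N mom_seriesE compD comp1 compXM compM compA -/N; ring.
  - by rewrite -OxyE {1}HH HyE [Ox * _]mulrC.
rewrite -shift_mom_series.
have : shift (mom_series beta) = N * (hat beta @z N).
  apply: (@fpsXI C); apply: (addrI 1); rewrite -mom_seriesE -fpsC1.
  by rewrite -(coef_mom_series0 beta) -shiftE.
by move=> ->; rewrite compM compA NE -OxyE OyE HH mulrC.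
Qed.

End PairSeries.
End MomentSeries.

(** * Deconvolution by the Marchenko-Pastur law *)

Section Deconvolution.
Variable C : numClosedFieldType.
Implicit Types (f g kappa rho mu : nat -> C) (x y N u v : fps C) (c : C).

(** The two equations determine [x] and [y] by [pair_unique], so a boxed convolution can be computed
    by exhibiting one solution of the system. *)
Lemma boxed_conv_series f g : exists x y,
  [/\ hat (boxed_conv f g) = x * y, hat f @z x = y & hat g @z y = x].
Proof.
have [beta gE] := moments_surj g.
have [x [y [h [hE hxy fx gy]]]] := pair_series f beta.
exists x, y; split=> //; last by rewrite -gy; congr (_ @z _); apply/hatP.
rewrite -hxy; apply: fpsP => k.
by rewrite hE -map_odd_iota -(boxed_conv_moment _ _ gE).
Qed.

Lemma boxed_conv_ext f f' g g' : f =+ f' -> g =+ g' ->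
  boxed_conv f g =+ boxed_conv f' g'.
Proof.
move=> ff gg k k0; apply: eq_bigr => P PNC.
have pos n (Q : {set {set 'I_n}}) B : Q \in NC n -> B \in Q -> (0 < #|B|)%N.
  rewrite -ncpartT => /andP[/partP[_ ne _ _] _] /ne[x xB].
  by apply/card_gt0P; exists x.
congr (_ * _); apply: eq_bigr => B BP; first by rewrite ff // (pos _ P).
by rewrite gg // (pos _ (kreweras P)) // kreweras_NC.
Qed.

Lemma pair_unique (a b p q x y x' y' : fps C) :
  a @z (p * x) = y -> b @z (q * y) = x ->
  a @z (p * x') = y' -> b @z (q * y') = x' -> x = x' /\ y = y'.
Proof.
move=> axy byx axy' byx'.
have both n : eq_upto n x x' /\ eq_upto n y y'.
  elim: n => // n [IHx IHy].
  by split; [rewrite -byx -byx'|rewrite -axy -axy'];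
    apply/comp_contract/eq_uptoM.
by split; apply: eq_upto_fps => n; have [] := both n.
Qed.

(** The R-series of the Marchenko-Pastur law; [hat (zeta c)] is [1 / (1 - c z)]. *)
Definition zeta c : nat -> C := fun k => c ^+ k.-1.

Lemma hat_zetaE c u : hat (zeta c) @z u =
  1 + fpsC c * fpsX * u * (hat (zeta c) @z u).
Proof.
rewrite {1}compE [coef _ 0]/= fpsC1.
have -> : shift (hat (zeta c)) = fpsC c * hat (zeta c).
  by apply: fpsP => k; rewrite fcoefCM /= /zeta /= exprS.
by rewrite compCM; ring.
Qed.

Lemma hat_zeta_unique c u v : v = 1 + fpsC c * fpsX * u * v ->
  hat (zeta c) @z u = v.
Proof.
move=> vE; have d0 : coef (1 - fpsC c * fpsX * u) 0 != 0.
  by rewrite fcoefB !fcoefM0 /= mulr0 mul0r subr0 oner_eq0.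
have E w : w = 1 + fpsC c * fpsX * u * w -> (1 - fpsC c * fpsX * u) * w = 1.
  by move=> wE; rewrite mulrBl mul1r {1}wE; ring.
by apply: (fps_mulI d0); rewrite !E //; apply: hat_zetaE.
Qed.

Lemma hat_Id : hat (@Id_series C) = 1.
Proof. by apply: fpsP => -[]. Qed.

Lemma zeta_inverse c : exists g,
  boxed_conv (zeta c) g =+ @Id_series C /\ boxed_conv g (zeta c) =+ @Id_series C.
Proof.
(* For the unit series the system reads [x y = 1] and [y = 1 + c z x y], which forces [y = 1 + c z]
   and [x = 1 / y]; the inverse [h] must then satisfy [h @z y = x]. *)
pose u := 1 + fpsC c * fpsX.
have u0 : coef u 0 != 0.
  by rewrite fcoefD fcoefM0 /= mulr0 addr0 oner_eq0.
have [w uw] := fps_inverse u0; have [h hu] := comp_surj w u0.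
have zw : hat (zeta c) @z w = u.
  by apply: hat_zeta_unique; rewrite -mulrA (mulrC w) uw mulr1.
exists (fun k => coef h k.-1); split; apply/hatP; rewrite hat_Id.
  have [x [y [-> zx]]] := boxed_conv_series (zeta c) (fun k => coef h k.-1).
  rewrite hat_coef => hy.
  have [||||-> ->] := @pair_unique (hat (zeta c)) h 1 1 x y w u;
    rewrite ?mul1r //.
  by rewrite mulrC.
have [x [y [->]]] := boxed_conv_series (fun k => coef h k.-1) (zeta c).
rewrite hat_coef => hx zy.
by have [||||-> ->] := @pair_unique h (hat (zeta c)) 1 1 x y u w; rewrite ?mul1r.
Qed.

(* Boxed convolution with zeta c is rho |-> c^-1 M(c rho). *)
Lemma boxed_conv_zeta_inv c g kappa : boxed_conv (zeta c) g =+ @Id_series C ->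
  (fun k => c * kappa k) =+
    moments_of_cumulants (fun k => c * boxed_conv kappa g k).
Proof.
move=> /hatP; rewrite hat_Id.
have [x1 [y1 [-> zx gy]]] := boxed_conv_series (zeta c) g => xy1.
have y1E : y1 = 1 + fpsC c * fpsX.
  by rewrite -zx hat_zetaE zx -mulrA xy1 mulr1.
have [x [y [xyE kx gx]]] := boxed_conv_series kappa g.
(* The candidate moment series. Checking its equation requires [(x * y) @z N], which [pair_unique]
   identifies with [(x1 @z hat kappa) * hat kappa], that is, [hat kappa / N]. *)
pose N := 1 + fpsC c * (fpsX * hat kappa).
have y1k : y1 @z hat kappa = N.
  by rewrite y1E compD comp1 compCM compX.
have x1N : (x1 @z hat kappa) * N = 1 by rewrite -y1k -compM xy1 comp1.
have NE : mom_series (fun k => c * boxed_conv kappa g k) = N.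
  apply: mom_series_unique; rewrite hatZ xyE compCM compM.
  have [||||-> ->] := @pair_unique (hat kappa) (hat g) N N (x @z N) (y @z N)
    (x1 @z hat kappa) (hat kappa).
  - by rewrite -compA kx.
  - by rewrite -compA gx.
  - by rewrite mulrC x1N comp_id.
  - by rewrite -y1k mulrC -compA gy.
  rewrite (_ : N * _ = fpsC c * ((x1 @z hat kappa) * N * hat kappa)); last by ring.
  by rewrite x1N mul1r /N; ring.
by apply/hatP; rewrite -shift_mom_series NE hatZ /N -fpsC1 mulrCA shift_CX.
Qed.

(** Let [m = F / c] be the moment series of [mu] and [N] that of the cumulants [c rho]. As
    [c m = F], the equation for [F] says that [N @z m = G]; then [m = 1 + (G - 1) / c], which is the
    functional equation of the outer moment series. *)
Lemma compressed_moments c (c0 : c != 0) mu (r F G : fps C) rho :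
    (forall k, (0 < k)%N -> coef F k = c * mu k) ->
    F = fpsC c + fpsX * (F * G * (r @z (F * G))) -> G = F + 1 - fpsC c ->
    hat rho = r @z (fpsC c) ->
  mu =+ moments_of_cumulants
          (fun k => c^-1 * moments_of_cumulants (fun j => c * rho j) k).
Proof.
move=> Fmu FE GE rhoE; pose d := fpsC c^-1; pose m := d * F.
have cd : fpsC c * d = 1 by rewrite -fpsCM mulfV // fpsC1.
have mc : m * fpsC c = F by rewrite /m mulrC mulrA cd mul1r.
pose N := mom_series (fun j => c * rho j).
have NG : N @z m = G.
  apply: (@fixpoint_unique _
    (fun n => 1 + fpsX * (m * n * (fpsC c * (r @z (m * n * fpsC c)))))).
  - move=> n u v uv; apply: eq_uptoD => //; apply: eq_uptoX.
    have muv : eq_upto n (m * u) (m * v) by apply: eq_uptoM.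
    apply: eq_uptoM => //; apply: eq_uptoM => //.
    by apply/eq_uptoW/comp_contract/eq_uptoM.
  - rewrite {1}/N mom_seriesE compD comp1 compXM compM compA -/N hatZ rhoE.
    by rewrite compCM compA compC; ring.
  - rewrite (_ : m * G * fpsC c = F * G); last by rewrite -mc; ring.
    move: FE; set t := r @z _ => FE.
    have -> : fpsX * (m * G * (fpsC c * t)) = fpsX * (F * G * t).
      by rewrite -mc; ring.
    by rewrite [in LHS]GE {1}FE; ring.
have NmE : N @z m = 1 + fpsX * (m * (shift N @z m)).
  by rewrite compE coef_mom_series0 fpsC1.
apply/hatP; rewrite -shift_mom_series (@mom_series_unique _ _ m).
  apply: fpsP => k; rewrite -[RHS]/(coef (d * F) k.+1) fcoefCM Fmu //.
  by rewrite mulKf.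
rewrite hatZ -shift_mom_series -/N compCM -/d.
apply: esym; rewrite (_ : 1 + _ = 1 + d * (N @z m - 1)); last by rewrite NmE; ring.
rewrite NG GE (_ : 1 + _ = m + (1 - fpsC c * d)); last by rewrite /m; ring.
by rewrite cd subrr addr0.
Qed.

Lemma free_cumulantsP mu : mu =+ moments_of_cumulants (free_cumulants mu).
Proof.
exact: (@xgetPex _ (fun=> 0) [set f | mu =+ moments_of_cumulants f]
  (moments_surj mu)).
Qed.

Lemma free_cumulants_moments f : free_cumulants (moments_of_cumulants f) =+ f.
Proof.
by apply: moments_inj => k k0; rewrite -free_cumulantsP.
Qed.

(** Full equality, index 0 included: the choice depends only on the set of candidates, which is the
    same for both. *)
Lemma free_cumulants_ext mu nu : mu =+ nu -> free_cumulants mu = free_cumulants nu.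
Proof.
move=> mn; congr xget; apply/funext => f; apply/propext.
by split=> h k k0; [rewrite -mn|rewrite mn]; rewrite ?h.
Qed.

Lemma eq_pos_sym f g : f =+ g -> g =+ f.
Proof. by move=> fg k k0; rewrite fg. Qed.

Lemma eq_pos_trans f g h : f =+ g -> g =+ h -> f =+ h.
Proof. by move=> fg gh k k0; rewrite fg // gh. Qed.

(** Eliminates the chosen cumulants and inverses from [[/]]. One direction computes a deconvolution;
    the other recovers [mu] from it, which is the source of uniqueness. *)
Lemma deconvP c (c0 : c != 0) mu rho :
  mu [/] marchenko_pastur c =+ moments_of_cumulants rho <->
  mu =+ moments_of_cumulants
          (fun k => c^-1 * moments_of_cumulants (fun j => c * rho j) k).
Proof.
set kmp := free_cumulants (marchenko_pastur c).
have kmpE : kmp =+ zeta c by apply: free_cumulants_moments.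
have inv : boxed_conv (zeta c) (boxed_inv kmp) =+ @Id_series C.
  have [|E _] := @xgetPex _ (fun=> 0) [set g | boxed_conv kmp g =+ @Id_series C /\
                          boxed_conv g kmp =+ @Id_series C].
    have [g [zg gz]] := zeta_inverse c; exists g; split.
      by apply: eq_pos_trans zg; apply: boxed_conv_ext.
    by apply: eq_pos_trans gz; apply: boxed_conv_ext.
  by apply: eq_pos_trans E; apply: boxed_conv_ext => //; apply: eq_pos_sym.
have kE := boxed_conv_zeta_inv (free_cumulants mu) inv.
split=> [/moments_inj rE|muE].
  apply: eq_pos_trans (free_cumulantsP mu) _.
  rewrite (@moments_ext _ (free_cumulants mu)
   (fun k => c^-1 * moments_of_cumulants (fun j => c * rho j) k)) // => k k0.
  rewrite (@moments_ext _ (fun j => c * rho j)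
    (fun j => c * boxed_conv (free_cumulants mu) (boxed_inv kmp) j)).
    by rewrite -kE // mulKf.
  by move=> j j0; rewrite rE.
suff -> : mu [/] marchenko_pastur c = moments_of_cumulants rho by [].
apply: moments_ext => k k0; apply: (mulfI c0).
have kmu : free_cumulants mu =+
    (fun k => c^-1 * moments_of_cumulants (fun j => c * rho j) k).
  by rewrite (free_cumulants_ext muE); apply: free_cumulants_moments.
have : moments_of_cumulants
    (fun k => c * boxed_conv (free_cumulants mu) (boxed_inv kmp) k)
   =+ moments_of_cumulants (fun j => c * rho j).
  by move=> j j0; rewrite -kE // kmu // mulVKf.
by move=> /moments_inj; apply.
Qed.

End Deconvolution.

(** * Schwinger-Dyson equations for free elements *)

Section StarAlgebra.
Variables (C : numClosedFieldType) (A : ncps C).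
Implicit Types S T : set A.

Lemma star_alg_genP S : star_subalgebra (star_alg_gen S).
Proof.
split=> [M [[]] //|x y Sx Sy M SM|k x Sx M SM|x y Sx Sy M SM|x Sx M SM];
  have [[_ MD MZ MM MS] _] := SM; [apply: MD|apply: MZ|apply: MM|apply: MS];
  by [exact: Sx|exact: Sy].
Qed.

Lemma sub_star_alg_gen S : S `<=` star_alg_gen S.
Proof. by move=> x Sx M [_]; apply. Qed.

Definition center (v : A) : A := v - (phi A v)%:A.

Lemma phiD x y : phi A (x + y) = phi A x + phi A y. Proof. exact: linearD. Qed.
Lemma phiZ k x : phi A (k *: x) = k * phi A x. Proof. exact: linearZ. Qed.
Lemma phiB x y : phi A (x - y) = phi A x - phi A y. Proof. exact: linearB. Qed.

Lemma phi_center v : phi A (center v) = 0.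
Proof. by rewrite phiB phiZ phi1 mulr1 subrr. Qed.

Lemma center_in S v : star_alg_gen S v -> star_alg_gen S (center v).
Proof.
have [S1 SD SZ SM SS] := star_alg_genP S => Sv.
by apply: SD => //; rewrite -scaleNr; apply: SZ.
Qed.

Lemma centerE v : v = center v + (phi A v)%:A.
Proof. by rewrite subrK. Qed.

Definition adj v (i : bool) : A := if i then star v else v.

End StarAlgebra.

Section SchwingerDyson.
Variables (C : numClosedFieldType) (A : ncps C) (a : A) (S : set A).
Variable kappa : seq bool -> C.

Let x := adj a.
Let AA := star_alg_gen [set a].
Let DD := star_alg_gen S.

Hypothesis a_free : star_free [set a] S.
Hypothesis a_cumulants : joint_cumulants x kappa.

Definition word_val (w : seq bool) : A := \prod_(i <- w) x i.

Lemma word_valE w : phi A (word_val w) = moment kappa w.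
Proof.
case: w => [|i w]; first by rewrite /word_val big_nil phi1.
rewrite a_cumulants // (NC_moment kappa (tnth (in_tuple (i :: w)))).
by congr moment; rewrite map_tnth_enum.
Qed.

Lemma word_val_in w : AA (word_val w).
Proof.
have [A1 AD AZ AM AS] := star_alg_genP [set a].
have Aa : AA a by apply: sub_star_alg_gen.
rewrite /word_val; elim: w => [|i w IH]; rewrite ?big_nil ?big_cons //.
by apply: AM => //; case: i; rewrite /x //; apply: AS.
Qed.

(** [Cen w] stands for a centered word in [a] and its adjoint, so that centering can be done and
    undone inside the words themselves. *)
Inductive letter := Gen of bool | Coef of A | Cen of seq bool.

Definition letter_val l : A :=
  match l with
  | Gen i => x i
  | Coef d => d
  | Cen w => center (word_val w)
  end.

Definition lval (l : seq letter) : A := \prod_(i <- l) letter_val i.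

(* A letter acts on functions Psi of (u, v), where u is the word of the block
   being read and v the product of the letters read since its last element. *)
Definition state := seq bool -> A -> C.

Definition op_gen i (Psi : state) : state :=
  fun u v => phi A v * Psi (rcons u i) 1 + Psi u (v * x i).
Definition op_word (w : seq bool) Psi : state := foldr op_gen Psi w.
Definition op l (Psi : state) : state :=
  match l with
  | Gen i => op_gen i Psi
  | Coef d => fun u v => Psi u (v * d)
  | Cen w => fun u v => op_word w Psi u v - phi A (word_val w) * Psi u v
  end.

Definition Psi0 : state := fun u v => kappa u * phi A v.
Definition ops (l : seq letter) (Psi : state) : state := foldr op Psi l.

Definition comb (Psi Psi' : state) k : state := fun u v => Psi u v + k * Psi' u v.

Lemma op_word_comb w Psi Psi' k :
  op_word w (comb Psi Psi' k) = comb (op_word w Psi) (op_word w Psi') k.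
Proof.
elim: w => //= i w ->; apply/funext => u; apply/funext => v.
rewrite /op_gen /comb; ring.
Qed.

Lemma op_comb l Psi Psi' k : op l (comb Psi Psi' k) = comb (op l Psi) (op l Psi') k.
Proof.
case: l => [i|d|w] //=; first exact: (op_word_comb [:: i]).
apply/funext => u; apply/funext => v; rewrite op_word_comb /comb; ring.
Qed.

Lemma ops_comb l Psi Psi' k :
  ops l (comb Psi Psi' k) = comb (ops l Psi) (ops l Psi') k.
Proof. by elim: l => //= i l ->; rewrite op_comb. Qed.

Definition linear_state (Psi : state) : Prop :=
  forall u k v v', Psi u (v + k *: v') = Psi u v + k * Psi u v'.

Lemma op_word_linear w Psi : linear_state Psi -> linear_state (op_word w Psi).
Proof.
move=> lin; elim: w => //= i w IH u k v v'.
rewrite /op_gen mulrDl -scalerAl IH phiD phiZ; ring.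
Qed.

Lemma ops_linear l Psi : linear_state Psi -> linear_state (ops l Psi).
Proof.
move=> lin; elim: l => //= -[i|d|w] l IH u k v v' /=.
- exact: (op_word_linear [:: i] IH).
- by rewrite mulrDl -scalerAl IH.
- by rewrite (op_word_linear _ IH) IH; ring.
Qed.

Lemma Psi0_linear : linear_state Psi0.
Proof. by move=> u k v v'; rewrite /Psi0 phiD phiZ; ring. Qed.

Lemma ops_cat l l' Psi : ops (l ++ l') Psi = ops l (ops l' Psi).
Proof. exact: foldr_cat. Qed.

Lemma lval_cat l l' : lval (l ++ l') = lval l * lval l'.
Proof. exact: big_cat. Qed.
Lemma lval_cons i l : lval (i :: l) = letter_val i * lval l.
Proof. exact: big_cons. Qed.
Lemma lval_Gen w : lval (map Gen w) = word_val w.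
Proof. by rewrite /lval big_map. Qed.
Lemma ops_Gen w Psi : ops (map Gen w) Psi = op_word w Psi.
Proof. by elim: w => //= i w ->. Qed.

Variable eps : bool.

(** Both terms are linear in each letter, so centering reduces the vanishing of the defect to words
    on which each term vanishes by freeness. *)
Definition defect (l : seq letter) : C :=
  phi A (x eps * lval l) - ops l Psi0 [:: eps] 1.

Lemma defect_cen V w W : defect (V ++ Cen w :: W) =
  defect (V ++ map Gen w ++ W) - phi A (word_val w) * defect (V ++ W).
Proof.
rewrite /defect !ops_cat !lval_cat lval_cons lval_Gen /= ops_Gen.
set Psi := ops W Psi0; set c := phi A (word_val w).
rewrite (_ : (fun u v => _) = comb (op_word w Psi) Psi (- c)); last first.
  by apply/funext => u; apply/funext => v; rewrite /comb mulNr.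
rewrite ops_comb /comb /center mulrBl mulrBr mulrBr phiB -!scalerAl mul1r.
rewrite -!scalerAr phiZ; ring.
Qed.

Lemma defect_coef V d W : defect (V ++ Coef d :: W) =
  defect (V ++ Coef (center d) :: W) + phi A d * defect (V ++ W).
Proof.
rewrite /defect !ops_cat !lval_cat !lval_cons /=.
set Psi := ops W Psi0.
have linP : linear_state Psi by apply/ops_linear/Psi0_linear.
rewrite (_ : (fun u v => Psi u (v * d)) =
    comb (fun u v => Psi u (v * center d)) Psi (phi A d)); last first.
  apply/funext => u; apply/funext => v; rewrite /comb -linP.
  by rewrite /center mulrBr -scalerAr mulr1 subrK.
rewrite ops_comb /comb {1}(centerE d) mulrDl mulrDr mulrDr phiD -!scalerAl mul1r.
rewrite -!scalerAr phiZ; ring.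
Qed.

Lemma defect_merge V d d' W :
  defect (V ++ Coef d :: Coef d' :: W) = defect (V ++ Coef (d * d') :: W).
Proof.
rewrite /defect !ops_cat !lval_cat !lval_cons /= !mulrA.
congr (_ - ops _ _ _ _).
by apply/funext => u; apply/funext => v; rewrite mulrA.
Qed.

(** Alternating products in which every factor but the first is centered. They end in the algebra of
    [S], so that freeness annihilates them against any further word in [a]. *)
Inductive zstate : A -> Prop :=
  | zstate0 y d : AA y -> DD d -> phi A d = 0 -> zstate (y * d)
  | zstateS v e d : zstate v -> AA e -> phi A e = 0 -> DD d -> phi A d = 0 ->
      zstate (v * e * d).

Let alt (u v : bool * A) := u.1 != v.1.
Let ok (u : bool * A) := (if u.1 then DD u.2 else AA u.2) /\ phi A u.2 = 0.

Lemma zstate_rep v : zstate v -> exists y c s,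
  [/\ AA y, ok (true, c), forall u, u \in s -> ok u,
      path alt (true, c) s & (last (true, c) s).1 = true /\
      v = y * (c * \prod_(u <- s) u.2)].
Proof.
elim=> [y d Ay Dd d0|{}v e d _ [y [c [s [Ay okc oks ps [ls ->]]]]] Ae e0 Dd d0].
  by exists y, d, [::]; split=> //; rewrite big_nil mulr1.
exists y, c, (s ++ [:: (false, e); (true, d)]); split=> //.
- move=> u; rewrite mem_cat !inE => /or3P[/oks //|/eqP->|/eqP->]; exact: conj.
- by rewrite cat_path ps /= /alt ls.
- by rewrite last_cat big_cat !big_cons big_nil /= mulr1 !mulrA.
Qed.

Lemma free_zero s : sorted alt s -> s != [::] -> (forall u, u \in s -> ok u) ->
  phi A (\prod_(u <- s) u.2) = 0.
Proof.
move=> ss s0 oks; apply: a_free => // u /oks [mu u0]; split=> //.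
by case: u.1 mu.
Qed.

(** Centering the two ends [y] and [q] leaves four alternating products of centered elements, none
    of them empty since all contain [c]. *)
Lemma zstate_zero v w : zstate v -> phi A (v * word_val w) = 0.
Proof.
move=> /zstate_rep[y [c [s [Ay okc oks ps [ls ->]]]]].
set q := word_val w; have Aq : AA q := word_val_in w.
have okF v' : AA v' -> ok (false, center v').
  by move=> Av; split; [exact: center_in|exact: phi_center].
have oks' u : u \in (true, c) :: s -> ok u by rewrite inE => /orP[/eqP->|/oks].
have z0 : phi A (\prod_(u <- (true, c) :: s) u.2) = 0.
  by apply: free_zero.
have z1 : phi A (\prod_(u <- (false, center y) :: (true, c) :: s) u.2) = 0.
  apply: free_zero => // u; rewrite inE => /orP[/eqP->|/oks'] //.
  exact: okF.
have z2 : phi A (\prod_(u <- ((true, c) :: s) ++ [:: (false, center q)]) u.2) = 0.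
  apply: free_zero => //=; first by rewrite cat_path ps /= /alt ls.
  move=> u; rewrite -cat_cons mem_cat => /orP[/oks' //|].
  by rewrite inE => /eqP->; apply: okF.
have z3 : phi A (\prod_(u <- (false, center y) :: ((true, c) :: s) ++
                              [:: (false, center q)]) u.2) = 0.
  apply: free_zero => //=; first by rewrite cat_path ps /= /alt ls.
  move=> u; rewrite inE => /orP[/eqP->|]; first exact: okF.
  rewrite -cat_cons mem_cat => /orP[/oks' //|].
  by rewrite inE => /eqP->; apply: okF.
move: z0 z1 z2 z3; rewrite !big_cons !big_cat !big_cons big_nil /= mulr1.
set p := \prod_(u <- s) u.2 => z0 z1 z2 z3.
rewrite (centerE y) (centerE q).
move: (center y) (center q) z1 z2 z3 => y' q' z1 z2 z3.
rewrite mulrDl mulrDl !mulrDr !phiD.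
rewrite -!scalerAl -!scalerAr -?scalerAl !mul1r ?mulr1 !phiZ -!mulrA.
by rewrite z0 z1 z2 z3 !mulr0 !addr0.
Qed.

(** A letter joining the block would close a gap whose expectation is zero, so all letters are
    skipped. *)
Lemma op_word_zero w Psi u v :
    (forall w', phi A (v * word_val w') = 0) ->
  op_word w Psi u v = Psi u (v * word_val w).
Proof.
elim: w v => [|i w IH] v v0 /=; first by rewrite /word_val big_nil mulr1.
rewrite /op_gen -[X in phi A X]mulr1.
have -> : phi A (v * 1) = 0 by have := v0 [::]; rewrite /word_val big_nil.
have E w' : v * x i * word_val w' = v * word_val (i :: w').
  by rewrite /word_val big_cons mulrA.
by rewrite mul0r add0r IH => [|w']; rewrite E.
Qed.

Definition tail (t : seq (seq bool * A)) : seq letter :=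
  flatten [seq [:: Cen p.1; Coef p.2] | p <- t].

Lemma tail_rcons t p : tail (rcons t p) = tail t ++ [:: Cen p.1; Coef p.2].
Proof. by rewrite /tail map_rcons flatten_rcons. Qed.

Let okt (t : seq (seq bool * A)) := forall p, p \in t -> DD p.2 /\ phi A p.2 = 0.

Lemma ops_tail_zero t w u v : okt t -> zstate v ->
  ops (tail t ++ map Gen w) Psi0 u v = 0.
Proof.
elim: t v => [|[w1 d] t IH] v ot zv /=.
  rewrite ops_Gen op_word_zero => [|w']; last exact: zstate_zero.
  by rewrite /Psi0 zstate_zero ?mulr0.
set Psi := ops _ _.
have linP : linear_state Psi by apply/ops_linear/Psi0_linear.
rewrite op_word_zero => [|w']; last exact: zstate_zero.
rewrite -mulNr -linP.
have [Dd d0] := ot (w1, d) (mem_head _ _).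
have -> : v * word_val w1 * d + - phi A (word_val w1) *: (v * d) =
    v * center (word_val w1) * d.
  by rewrite /center mulrBr mulrBl -scalerAr mulr1 -scalerAl scaleNr.
apply: IH => [p pt|]; first by apply: ot; rewrite inE pt orbT.
apply: zstateS => //; last exact: phi_center.
by apply: center_in; apply: word_val_in.
Qed.

Lemma ops_normal_zero w0 d t w u v : DD d -> phi A d = 0 -> okt t -> AA v ->
  ops (map Gen w0 ++ Coef d :: tail t ++ map Gen w) Psi0 u v = 0.
Proof.
move=> Dd d0 ot; have [A1 _ _ AM AS] := star_alg_genP [set a].
elim: w0 u v => [|i w0 IH] u v Av /=.
  by apply: ops_tail_zero => //; apply: zstate0.
rewrite /op_gen !IH ?mulr0 ?addr0 //.
by apply: AM => //; have := word_val_in [:: i]; rewrite /word_val big_seq1.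
Qed.

Lemma zstate_tail t v : okt t -> zstate v -> zstate (v * lval (tail t)).
Proof.
elim: t v => [|[w1 d] t IH] v ot zv; first by rewrite /lval big_nil mulr1.
have [Dd d0] := ot (w1, d) (mem_head _ _).
rewrite /= !lval_cons /= !mulrA; apply: IH => [p pt|].
  by apply: ot; rewrite inE pt orbT.
by apply: zstateS; rewrite ?phi_center //; apply: center_in; apply: word_val_in.
Qed.

Lemma defect_normal w0 d t w : DD d -> phi A d = 0 -> okt t ->
  defect (map Gen w0 ++ Coef d :: tail t ++ map Gen w) = 0.
Proof.
move=> Dd d0 ot; have [A1 _ _ AM _] := star_alg_genP [set a].
rewrite /defect ops_normal_zero // subr0.
rewrite lval_cat lval_cons lval_cat !lval_Gen /= !mulrA.
apply/zstate_zero/zstate_tail => //; apply: zstate0 => //.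
by have := word_val_in (eps :: w0); rewrite /word_val big_cons.
Qed.

Let is_coef l := if l is Coef _ then true else false.
Let is_cen l := if l is Cen _ then true else false.

Fixpoint good (l : seq letter) : Prop :=
  match l with
  | Coef d :: l' => DD d /\ good l'
  | _ :: l' => good l'
  | [::] => True
  end.

Lemma good_cat l l' : good (l ++ l') <-> good l /\ good l'.
Proof.
elim: l => [|[i|d|w] l IH] /=; rewrite ?IH; by [split=> [|[]]|split=> [[? []]|[[? ?]]]].
Qed.

Lemma good_Gen w : good (map Gen w).
Proof. by elim: w. Qed.

Let count_Gen p w : ~~ p (Gen true) -> ~~ p (Gen false) ->
  count p (map Gen w) = 0%N.
Proof. by move=> pt pf; elim: w => //= -[] w ->; rewrite ?(negbTE pt) ?(negbTE pf). Qed.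

(** Expanding [Cen w] into the word minus a scalar leaves the number of coefficients unchanged, so
    an induction on that number may assume that no [Cen] occurs. *)
Lemma defect_uncen k :
    (forall l, ~~ has is_cen l -> count is_coef l = k -> good l -> defect l = 0) ->
  forall l, count is_coef l = k -> good l -> defect l = 0.
Proof.
move=> H l; rewrite -[l]/([::] ++ l).
have : ~~ has is_cen [::] by [].
elim: l [::] => [|i l IH] V nV; first by rewrite cats0; apply: H.
case: i => [i|d|w] lk; last first.
- move: lk; rewrite count_cat /= add0n => lk /good_cat[gV gl].
  rewrite defect_cen catA !IH ?mulr0 ?subr0 //.
  + by rewrite count_cat.
  + by apply/good_cat.
  + by rewrite has_cat negb_or nV /=; elim: (w).
  + by rewrite !count_cat count_Gen // addn0.
  + by apply/good_cat; split=> //; apply/good_cat; split=> //; apply: good_Gen.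
- by rewrite -cat_rcons in lk *; apply: IH; rewrite // has_rcons.
- by rewrite -cat_rcons in lk *; apply: IH; rewrite // has_rcons.
Qed.

(** The word is centered from left to right: [tail t] is done and [w] is a pending run of
    generators. At the next coefficient [d1], centering [w] costs a word in which two coefficients
    merge, and centering [d1] costs a word without it; both have fewer coefficients and fall under
    the first hypothesis. *)
Lemma defect_process k w0 d t w l :
    (forall l, (count is_coef l < k)%N -> good l -> defect l = 0) ->
    DD d -> phi A d = 0 -> okt t -> ~~ has is_cen l -> good l ->
    (count is_coef (Coef d :: tail t ++ l) <= k)%N ->
  defect (map Gen w0 ++ Coef d :: tail t ++ map Gen w ++ l) = 0.
Proof.
move=> low Dd d0; have [_ _ _ DM _] := star_alg_genP S.
have gt t' : okt t' -> good (tail t').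
  elim: t' => //= -[w1 d1] t' IH ot; split.
    by have [] := ot _ (mem_head _ _).
  by apply: IH => p pt; apply: ot; rewrite inE pt orbT.
elim: l t w => [|[i|d1|//] l IH] t w ot nl gl lk.
- by rewrite cats0; apply: defect_normal.
- rewrite -(cat_rcons (Gen i)) -map_rcons; apply: IH => //.
  by move: lk; rewrite /= !count_cat.
pose L := map Gen w0 ++ Coef d :: tail t.
have LE W : map Gen w0 ++ Coef d :: tail t ++ W = L ++ W by rewrite /L -catA.
have [Dd1 gl'] := gl.
have cL W : count is_coef (L ++ W) =
    (count is_coef (Coef d :: tail t) + count is_coef W)%N.
  by rewrite /L !count_cat count_Gen.
have gL : good L by apply/good_cat; split; [exact: good_Gen|split=> //; apply: gt].
have cenE := defect_cen L w (Coef d1 :: l).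
rewrite LE; apply/eqP; rewrite -[X in X == 0]addr0.
have merged : defect (L ++ Coef d1 :: l) = 0.
  have [L' [d' [LE' Dd']]] : exists L' d', L = rcons L' (Coef d') /\ DD d'.
    rewrite /L; case/lastP: (t) ot => [|t' [w1 d2]] ot.
      by exists (map Gen w0), d; rewrite cats1.
    exists (map Gen w0 ++ Coef d :: tail t' ++ [:: Cen w1]), d2; split.
      by rewrite tail_rcons -cats1 -!catA /= -!catA.
    by have [] := ot (w1, d2); rewrite // mem_rcons mem_head.
  move: cL gL; rewrite LE' => cL gL; rewrite cat_rcons defect_merge; apply: low.
    have := cL (Coef d1 :: l); rewrite -cats1 -catA !count_cat /= => cE.
    apply: leq_trans lk; rewrite /= count_cat /=; move: cE.
    by rewrite /= !add1n !addnS !addSn => -[->].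
  move: gL; rewrite -cats1 => /good_cat[gL' _]; apply/good_cat; split=> //.
  by split=> //; apply: DM.
have lower : defect (L ++ Cen w :: l) = 0.
  apply: low; last by apply/good_cat.
  by rewrite cL; move: lk; rewrite /= !count_cat /=; lia.
have main : defect (L ++ Cen w :: Coef d1 :: l) = 0.
  rewrite -[L ++ _](cat_rcons (Cen w)) defect_coef.
  rewrite [rcons L (Cen w) ++ l]cat_rcons lower mulr0 addr0.
  have -> : rcons L (Cen w) ++ Coef (center d1) :: l =
     map Gen w0 ++ Coef d :: tail (rcons t (w, center d1)) ++ map Gen [::] ++ l.
    by rewrite tail_rcons -(cats1 L) /L -!catA /= -?catA.
  apply: IH => //.
    move=> p; rewrite mem_rcons inE => /orP[/eqP->|/ot//]; split.
      exact: center_in.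
    exact: phi_center.
  by move: lk; rewrite tail_rcons /= !count_cat /=; lia.
by move: cenE; rewrite main merged mulr0 subr0 addr0 => <-.
Qed.

(** Induction on the number of coefficients: with none, the operators perform [scan]; otherwise
    centering reduces to fewer. The right-hand side sums over the block of the leading letter its
    cumulant times the expectations of its gaps. *)
Lemma schwinger_dyson l : good l ->
  phi A (x eps * lval l) = ops l Psi0 [:: eps] 1.
Proof.
move=> gl; apply/eqP; rewrite -subr_eq0; apply/eqP; rewrite -/(defect l).
have [k] := ubnP (count is_coef l); elim: k l gl => // k IH l gl lk.
have low l' : (count is_coef l' < count is_coef l)%N -> good l' -> defect l' = 0.
  by move=> l'l gl'; apply: IH => //; apply: leq_trans l'l _.
apply: (@defect_uncen (count is_coef l)) => // {gl lk IH}l' ncl'.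
move: low; move: (count is_coef l) => {}k low l'k gl'.
have split_l : (exists w, l' = map Gen w) \/
    exists w d W, l' = map Gen w ++ Coef d :: W.
  elim: l' ncl' {l'k gl'} => [|[i|d|//] W IHl] /= nc; first by left; exists [::].
    case: (IHl nc) => [[w ->]|[w [d [W' ->]]]]; [left; by exists (i :: w)|right].
    by exists (i :: w), d, W'.
  by right; exists [::], d, W.
case: split_l => [[w wE]|[w [d [W lE]]]].
  rewrite /defect wE lval_Gen ops_Gen.
  have opE u v : op_word w Psi0 u (word_val v) = scan kappa (moment kappa) u v w.
    elim: w u v {wE} => [|i w IHw] u v /=; first by rewrite /Psi0 word_valE.
    rewrite /op_gen word_valE -IHw -IHw /word_val big_nil -(cats1 v) big_cat big_seq1.
    by [].
  have := opE [:: eps] [::]; rewrite {1}/word_val big_nil => ->.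
  have -> : x eps * word_val w = word_val (eps :: w) by rewrite /word_val big_cons.
  by rewrite word_valE moment_cons subrr.
move: ncl' l'k gl'; rewrite lE has_cat negb_or count_cat count_Gen //= add0n.
move=> /andP[_ ncW] Wk /good_cat[_ [Dd gW]].
have lower : defect (map Gen w ++ W) = 0.
  apply: low; first by rewrite count_cat count_Gen // add0n -Wk.
  by apply/good_cat; split=> //; apply: good_Gen.
rewrite defect_coef lower mulr0 addr0.
apply: (@defect_process k w (center d) [::] [::] W) => //.
- exact: center_in.
- exact: phi_center.
- by rewrite /= -Wk.
Qed.

End SchwingerDyson.

(** * Compressions of the sum of an R-diagonal element and a free element *)

Lemma rcons_alternating b s :
  rcons (alternating b s) (b (+) odd s) = alternating b s.+1.
Proof.
elim: s b => [|s IH] b /=; first by rewrite addbF.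
by congr cons; rewrite -[RHS]/(alternating (~~ b) s.+1) -IH addNb addbN.
Qed.

Section RDiagonalCumulants.
Variables (C : numClosedFieldType) (alpha : nat -> C).
Let kappa := rdiag_series alpha.

Lemma flatten_alternating b n :
  flatten (nseq n [:: b; ~~ b]) = alternating b n.*2.
Proof. by elim: n => //= n ->; rewrite negbK. Qed.

Lemma rdiag_seriesE w : kappa w = \sum_(1 <= n < (size w).+1) alpha n *
  ((w == alternating false n.*2) + (w == alternating true n.*2))%:R.
Proof.
apply: eq_bigr => n _.
by rewrite (flatten_alternating false) (flatten_alternating true).
Qed.

Lemma sorted_alternating b n : sorted (fun i j : bool => i != j) (alternating b n).
Proof.
elim: n b => // -[|n] IH b //.
by apply/andP; split; [case: b|apply: IH].
Qed.

Lemma rdiag_alternating b r : kappa (alternating b r.+1.*2) = alpha r.+1.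
Proof.
rewrite rdiag_seriesE size_alternating (bigD1_seq r.+1) ?iota_uniq //=; last first.
  by rewrite mem_index_iota doubleS; lia.
rewrite big1 ?addr0 => [|n nr]; first by case: b; rewrite eqxx ?mulr1.
have neq i : (alternating b r.+1.*2 == alternating i n.*2) = false.
  apply/negP => /eqP /(congr1 size); rewrite !size_alternating => /double_inj E.
  by rewrite E eqxx in nr.
by rewrite !neq mulr0.
Qed.

Lemma rdiag_odd w : odd (size w) -> kappa w = 0.
Proof.
move=> ow; rewrite rdiag_seriesE big1 // => n _.
have neq i : (w == alternating i n.*2) = false.
  by apply/negP => /eqP E; move: ow; rewrite E size_alternating odd_double.
by rewrite !neq mulr0.
Qed.

(** The appended letter repeats the last one of the alternating word, which no word with a nonzero
    cumulant allows. *)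
Lemma rdiag_repeat b s t :
  kappa (rcons (alternating b s.+1) (b (+) odd s) ++ t) = 0.
Proof.
set w := _ ++ t; rewrite rdiag_seriesE big1 // => n _.
have neq i : (w == alternating i n.*2) = false.
  apply/negP => /eqP E; have := sorted_alternating i n.*2; rewrite -E /w.
  rewrite -rcons_alternating cat_rcons; move: (b (+) odd s) (alternating b s) => c l.
  by rewrite -cats1 -catA sorted_cat_cons /= eqxx andbF.
by rewrite !neq mulr0.
Qed.

End RDiagonalCumulants.

Section AlternatingProducts.
Variables (C : numClosedFieldType) (A : ncps C) (p : A).
Implicit Types v : A.

Definition side (i : bool) : A := if i then 1 else p.

Fixpoint alt_prod v i n : A :=
  if n is n'.+1 then side i * adj v i * alt_prod v (~~ i) n' else side i.

(* alt_series v false and alt_series v true are the moment series of p v v* p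
   and of v* p v, with constant terms phi(p) and 1. *)
Definition alt_series v i : fps C := Fps (fun k => phi A (alt_prod v i k.*2)).

Lemma alt_prod_double v i k : alt_prod v i k.*2 =
  (side i * adj v i * side (~~ i) * adj v (~~ i)) ^+ k * side i.
Proof.
elim: k => [|k IH]; first by rewrite expr0 mul1r.
by rewrite doubleS /= negbK IH exprS !mulrA.
Qed.

Hypotheses (tr : tracial A) (pp : p * p = p).

Lemma side_idem i : side i * side i = side i.
Proof. by case: i; rewrite //= mulr1. Qed.

Lemma side_alt_prod v i n : side i * alt_prod v i n = alt_prod v i n.
Proof. by case: n => [|n] /=; rewrite ?side_idem // !mulrA side_idem. Qed.

Lemma alt_series_compressed v k : phi A p != 0 ->
  coef (alt_series v false) k.+1 = phi A p * compressed_distr p v k.+1.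
Proof.
move=> p0; rewrite mulVKf // -[LHS]/(phi A (alt_prod v false k.+1.*2)).
rewrite alt_prod_double /= mulr1.
congr (phi A _); elim: k => [|k IH]; first by rewrite !expr1.
rewrite exprS -mulrA IH [in RHS]exprS; set y := (_ ^+ k.+1).
have py : p * y = y by rewrite /y exprS !mulrA pp.
by rewrite -[in RHS]mulrA py.
Qed.

Lemma alt_series_true v :
  alt_series v true = alt_series v false + 1 - fpsC (phi A p).
Proof.
apply: fpsP => -[|k]; first by rewrite /= phi1 addrAC subrr add0r.
rewrite -[LHS]/(phi A (alt_prod v true k.+1.*2)).
rewrite -[RHS]/(phi A (alt_prod v false k.+1.*2) + 0 - 0) addr0 subr0.
rewrite !alt_prod_double /= !mulr1 !mul1r.
have cyc (x y : A) n : phi A ((x * y) ^+ n.+1) = phi A ((y * x) ^+ n.+1).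
  have -> : (x * y) ^+ n.+1 = x * ((y * x) ^+ n * y).
    elim: n => [|n IH]; first by rewrite expr1 expr0 mul1r.
    by rewrite exprS IH exprS !mulrA.
  by rewrite tr -mulrA -exprSr.
rewrite -(mulrA (star v)) cyc [RHS]tr; congr (phi A _).
by rewrite exprS !mulrA pp.
Qed.

End AlternatingProducts.

(** * Expansion along the block of a leading [a] *)

Section Expansion.
Variables (C : numClosedFieldType) (A : ncps C) (a b p : A) (S : set A).
Variable alpha : nat -> C.

Let DD := star_alg_gen S.
Let kappa := rdiag_series alpha.
Let e := side p.
Let Q := alt_prod p (a + b).

Hypothesis a_free : star_free [set a] S.
Hypothesis a_cumulants : joint_cumulants (adj a) kappa.
Hypotheses (pD : DD p) (bD : DD b).

Let eD i : DD (e i).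
Proof. by case: i => //; have [] := star_alg_genP S. Qed.

Let bsD i : DD (adj b i).
Proof. by case: i => //; have [_ _ _ _] := star_alg_genP S; apply. Qed.

Let adjD i : adj (a + b) i = adj a i + adj b i.
Proof. by case: i; rewrite //= starD. Qed.

Section WithCoefficient.
Variable d : A.
Hypothesis dD : DD d.

(** The action of the word [Q i n * d], each letter [a + b] being split into a generator and a
    coefficient whose actions are added. *)
Fixpoint alt_state i n : state A :=
  if n is n'.+1 then
    let Psi := alt_state (~~ i) n' in
    op a (Coef (e i)) (comb (op a (Gen A i) Psi) (op a (Coef (adj b i)) Psi) 1)
  else op a (Coef (e i)) (op a (Coef d) (Psi0 kappa)).

Let alt_stateS i n : alt_state i n.+1 =
  comb (ops a [:: Coef (e i); Gen A i] (alt_state (~~ i) n))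
       (ops a [:: Coef (e i); Coef (adj b i)] (alt_state (~~ i) n)) 1.
Proof. by []. Qed.

Lemma alt_state_SD i n eps V : good S V ->
  phi A (adj a eps * (lval a V * (Q i n * d))) = ops a V (alt_state i n) [:: eps] 1.
Proof.
elim: n i V => [|n IH] i V gV.
  have gV' : good S (V ++ [:: Coef (e i); Coef d]).
    by apply/good_cat; split; [|split; [exact: eD|split]].
  rewrite -(ops_cat a V [:: Coef (e i); Coef d]).
  rewrite -(schwinger_dyson a_free a_cumulants) //.
  by rewrite lval_cat !lval_cons /lval big_nil /= mulr1 !mulrA.
have gx : good S (V ++ [:: Coef (e i); Gen A i]).
  by apply/good_cat; split; [|split; [exact: eD|]].
have gb : good S (V ++ [:: Coef (e i); Coef (adj b i)]).
  by apply/good_cat; split; [|split; [exact: eD|split; [exact: bsD|]]].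
rewrite alt_stateS ops_comb -!ops_cat /comb mul1r -!IH //.
rewrite !lval_cat !lval_cons /lval !big_nil.
by rewrite -phiD -mulrDr !mulr1 -!mulrA -mulrDr -mulrDr -mulrDl -adjD.
Qed.

Lemma alt_state_linear i n : linear_state (alt_state i n).
Proof.
elim: n i => [|n IH] i.
  exact: (ops_linear a [:: Coef (e i); Coef d] (Psi0_linear kappa)).
rewrite alt_stateS => u k v v'; rewrite /comb !(ops_linear a _ (IH (~~ i))); ring.
Qed.

Lemma alt_state_dead i n u v : (forall t, kappa (u ++ t) = 0) ->
  alt_state i n u v = 0.
Proof.
elim: n i u v => [|n IH] i u v dead.
  by rewrite /= /Psi0 -[u]cats0 dead mul0r.
rewrite alt_stateS /comb /= /op_gen !IH ?mulr0 ?addr0 // => t.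
by rewrite cat_rcons dead.
Qed.

(** Skipped generators recombine with the letters [b] into [a + b], so the gaps are again products
    [Q]; [j] is the position of the next letter of the block. *)
Lemma alt_state_expand i n u v : alt_state i n u v =
  kappa u * phi A (v * (Q i n * d)) +
  \sum_(j < n) phi A (v * Q i j) *
     alt_state (i (+) odd j.+1) (n - j.+1) (rcons u (i (+) odd j)) 1.
Proof.
elim: n i u v => [|n IH] i u v.
  by rewrite big_ord0 addr0 /= /Psi0 mulrA.
rewrite alt_stateS /comb /= /op_gen -addrA -(alt_state_linear _ _ u 1).
rewrite scale1r -mulrDr -adjD (IH (~~ i) u) big_ord_recl /= addbF addbT subn1 addrCA.
rewrite !mulrA; congr (_ + (_ + _)).
apply: eq_bigr => j _; rewrite /= !mulrA subSS.
by rewrite !addNb !addbN.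
Qed.

(* i is the side of the first letter read, and s >= 1 the number of letters
   already in its block. *)
Let block i s n := alt_state (i (+) odd s) n (alternating i s) 1.

(** The block of an R-diagonal element alternates, and so does the word being read; hence the gap
    before the next letter has even length. *)
Let blockE i s n : block i s.+1 n =
  kappa (alternating i s.+1) * phi A (Q (i (+) odd s.+1) n * d) +
  \sum_(j < n) (if odd j then 0 else
     phi A (Q (i (+) odd s.+1) j) * block i s.+2 (n - j.+1)).
Proof.
rewrite /block alt_state_expand mul1r; congr (_ + _); apply: eq_bigr => j _.
rewrite mul1r [odd j.+1]/(~~ odd j); case: ifP => oj.
  rewrite alt_state_dead ?mulr0 // => t.
  by rewrite -addbA addbT [odd s.+1]/(~~ odd s) negbK; apply: rdiag_repeat.
by rewrite addbF addbT rcons_alternating -addbN.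
Qed.

Definition coef_series i : fps C := Fps (fun k => phi A (Q i k.*2 * d)).
Definition coef_series_odd i : fps C := Fps (fun k => phi A (Q i k.*2.+1 * d)).

Let q := alt_series p (a + b).
Let S0 i s := Fps (fun k => block i s k.*2).
Let S1 i s := Fps (fun k => block i s k.*2.+1).

Let S1E i s : S1 i s.+1 =
  fpsC (kappa (alternating i s.+1)) * coef_series_odd (i (+) odd s.+1) +
  q (i (+) odd s.+1) * S0 i s.+2.
Proof.
apply: fpsP => k; rewrite fcoefD fcoefCM fcoefM [LHS]/= blockE; congr (_ + _).
rewrite (sum_even_doubleS (fun j => phi A (Q (i (+) odd s.+1) j) *
                                    block i s.+2 (k.*2.+1 - j.+1))).
by apply: eq_bigr => j _; rewrite subSS -doubleB.
Qed.

Let S0E i s : S0 i s.+1 =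
  fpsC (kappa (alternating i s.+1)) * coef_series (i (+) odd s.+1) +
  fpsX * q (i (+) odd s.+1) * S1 i s.+2.
Proof.
apply: fpsP => k; rewrite fcoefD fcoefCM fcoefXMM [LHS]/= blockE; congr (_ + _).
rewrite (sum_even_double (fun j => phi A (Q (i (+) odd s.+1) j) *
                                    block i s.+2 (k.*2 - j.+1))).
apply: eq_bigr => j _; congr (_ * block _ _ _).
by have := ltn_ord j; lia.
Qed.

(** A block of [2r] letters has weight [alpha r], and its gaps contribute [q (~~ i)] and [q i] in
    turn, the last one carrying [d]. Odd cumulants vanish, so one stage of [comp_geom] is made of
    two letters, that is, of [S1E] and [S0E] together. *)
Lemma rdiag_part i :
  Fps (fun k => phi A (adj a i * (Q (~~ i) k.*2.+1 * d))) =
    (hat alpha @z (q i * q (~~ i))) * (q (~~ i) * coef_series i) /\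
  Fps (fun k => phi A (adj a i * (Q (~~ i) k.*2 * d))) =
    (hat alpha @z (q i * q (~~ i))) * (fpsX * q (~~ i) * coef_series_odd i).
Proof.
have start n : phi A (adj a i * (Q (~~ i) n * d)) = block i 1 n.
  have := @alt_state_SD (~~ i) n i [::] I.
  by rewrite /lval big_nil mul1r /block /= addbT.
have odd0 r : kappa (alternating i r.*2.+1) = 0.
  by apply: rdiag_odd; rewrite size_alternating /= odd_double.
have oddE r : i (+) odd r.*2.+1 = ~~ i by rewrite /= odd_double addbT.
have evenE r : i (+) odd r.*2.+2 = i by rewrite /= odd_double addbF.
split.
  pose T r := S1 i r.*2.+1.
  rewrite -(@comp_geom _ (fun r => alpha r.+1) T); first by apply: fpsP => k /=.
  move=> r; rewrite /T S1E S0E odd0 oddE evenE fpsC0 mul0r add0r.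
  by rewrite -doubleS /kappa rdiag_alternating; ring.
pose T r := S0 i r.*2.+1.
rewrite -(@comp_geom _ (fun r => alpha r.+1) T); first by apply: fpsP => k /=.
move=> r; rewrite /T S0E S1E odd0 oddE evenE fpsC0 mul0r add0r.
by rewrite -doubleS /kappa rdiag_alternating; ring.
Qed.

End WithCoefficient.
End Expansion.

(** * Subordination of [a + b] to [b] *)

Section Compression.
Variables (C : numClosedFieldType) (A : ncps C) (a b p : A) (S : set A).
Variable alpha : nat -> C.

Let DD := star_alg_gen S.
Let e := side p.
Let Q := alt_prod p (a + b).
Let q := alt_series p (a + b).
Let cs := coef_series a b p.
Let cso := coef_series_odd a b p.

Hypothesis a_free : star_free [set a] S.
Hypothesis a_cumulants : joint_cumulants (adj a) (rdiag_series alpha).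
Hypotheses (pD : DD p) (bD : DD b).
Hypotheses (tr : tracial A) (pp : p * p = p).

Let eD i : DD (e i).
Proof. by case: i => //; have [] := star_alg_genP S. Qed.

Let debD d i : DD d -> DD (d * e i * adj b i).
Proof.
have [_ _ _ DM DS] := star_alg_genP S => dD.
by apply: (DM); [apply: DM => //; apply: eD|case: i => //; apply: DS].
Qed.

Let adjD i : adj (a + b) i = adj a i + adj b i.
Proof. by case: i; rewrite //= starD. Qed.

Let t i := hat alpha @z (q i * q (~~ i)).
Let Lam i := fpsX * (t i * q (~~ i)).

(** By traciality the leading [e i], or [e i * adj b i], travels to the right end and is absorbed in
    the coefficient, leaving a leading [a] or a shorter product. *)
Let step d i n : phi A (Q i n.+1 * d) =
  phi A (adj a i * (Q (~~ i) n * (d * e i))) +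
  phi A (Q (~~ i) n * (d * e i * adj b i)).
Proof.
rewrite -[Q i n.+1]/(e i * adj (a + b) i * Q (~~ i) n) adjD.
rewrite mulrDr !mulrDl phiD; congr (_ + _).
  by rewrite -!mulrA tr !mulrA.
by rewrite -!mulrA mulrA tr !mulrA.
Qed.

Let e_absorb d i n : phi A (Q i n * (d * e i)) = phi A (Q i n * d).
Proof. by rewrite mulrA tr mulrA side_alt_prod. Qed.

Let cs_e d i : cs (d * e i) i = cs d i.
Proof. by apply: fpsP => k; exact: (e_absorb d i k.*2). Qed.

Let cso_e d i : cso (d * e i) i = cso d i.
Proof. by apply: fpsP => k; exact: (e_absorb d i k.*2.+1). Qed.

Let deD d i : DD d -> DD (d * e i).
Proof. by have [_ _ _ DM _] := star_alg_genP S => dD; apply: DM => //; apply: eD. Qed.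

(** A leading [a] reproduces the same series with the factor [Lam i]; a leading [b] lengthens the
    coefficient and changes side. *)
Let csE d i : DD d -> cs d i =
  fpsC (phi A (e i * d)) + Lam i * cs d i + fpsX * cso (d * e i * adj b i) (~~ i).
Proof.
move=> dD; have [R _] := rdiag_part a_free a_cumulants pD bD (deD i dD) i.
have -> : Lam i * cs d i = fpsX * (t i * (q (~~ i) * cs d i)) by rewrite /Lam; ring.
rewrite -{2}cs_e -[t i * _]R; apply: fpsP => -[|k].
  by rewrite !fcoefD !fcoefXM0 !addr0.
by rewrite !fcoefD !fcoefXMS add0r -[LHS]/(phi A (Q i k.*2.+2 * d)) step.
Qed.

Let csoE d i : DD d -> cso d i =
  Lam i * cso d i + cs (d * e i * adj b i) (~~ i).
Proof.
move=> dD; have [_ R] := rdiag_part a_free a_cumulants pD bD (deD i dD) i.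
have -> : Lam i * cso d i = t i * (fpsX * q (~~ i) * cso d i) by rewrite /Lam; ring.
rewrite -{2}cso_e -[t i * _]R; apply: fpsP => k.
by rewrite fcoefD -[LHS]/(phi A (Q i k.*2.+1 * d)) step.
Qed.

(* Each gap between two letters b of an outer face of a noncrossing diagram
   contributes a factor Z i, depending only on its side. *)
Lemma alt_series_subordination : exists Z : bool -> fps C,
  forall i, Z i * (1 - Lam i) = 1 /\
            q i = (alt_series p b i @z (Z i * Z (~~ i))) * Z i.
Proof.
have inv i : exists z, z * (1 - Lam i) = 1.
  have [|z zE] := @fps_inverse _ (1 - Lam i).
    by rewrite fcoefB fcoefXM0 subr0 oner_eq0.
  by exists z; rewrite mulrC.
have [[z0 z0E] [z1 z1E]] := (inv false, inv true).
pose Z (i : bool) := if i then z1 else z0; exists Z => i.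
have ZE j : Z j * (1 - Lam j) = 1 by case: j.
split=> //; pose y := e i * adj b i * e (~~ i) * adj b (~~ i).
have yD k : DD (y ^+ k).
  have [D1 _ _ DM _] := star_alg_genP S.
  elim: k => [|k IH]; rewrite ?expr0 // exprS; apply: DM => //.
  by apply: debD; have := debD i D1; rewrite mul1r.
(* The coefficient has absorbed [k] pairs of letters [b]; eliminating the odd series yields a
   recursion for [comp_geom]. *)
pose T k := cs (y ^+ k) i.
have TE k : T k = fpsC (phi A (alt_prod p b i k.*2)) * Z i +
                  fpsX * (Z i * Z (~~ i)) * T k.+1.
  rewrite /T; set d := y ^+ k.
  have d1E : d * e i * adj b i * e (~~ i) * adj b (~~ i) = y ^+ k.+1.
    by rewrite exprSr /y !mulrA.
  have E1 := csE i (yD k); have E2 := csoE (~~ i) (debD i (yD k)).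
  rewrite -/d in E1 E2; rewrite negbK d1E in E2.
  have -> : phi A (alt_prod p b i k.*2) = phi A (e i * d).
    by rewrite alt_prod_double tr.
  have s1 : cs d i * (1 - Lam i) =
     fpsC (phi A (e i * d)) + fpsX * cso (d * e i * adj b i) (~~ i).
    by rewrite mulrBr mulr1 {1}E1; ring.
  have s2 : cso (d * e i * adj b i) (~~ i) * (1 - Lam (~~ i)) = cs (y ^+ k.+1) i.
    by rewrite mulrBr mulr1 {1}E2; ring.
  rewrite -s2 (_ : fpsX * _ * _ = fpsX * cso (d * e i * adj b i) (~~ i) *
     (Z (~~ i) * (1 - Lam (~~ i))) * Z i); last by ring.
  by rewrite ZE mulr1 -mulrDl -s1 -mulrA (mulrC _ (Z i)) ZE mulr1.
rewrite -(@comp_geom _ (fun k => phi A (alt_prod p b i k.*2)) T) //.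
by apply: fpsP => k; rewrite /T expr0 /= mulr1.
Qed.

Lemma alt_series_sum (r : fps C) :
    let f := alt_series p b in
    f false = fpsC (phi A p) +
       fpsX * (f false * f true * (r @z (f false * f true))) ->
  q false = fpsC (phi A p) + fpsX * (q false * q true *
     ((hat alpha + r) @z (q false * q true))).
Proof.
move=> f fE; have [Z ZE] := alt_series_subordination.
have [] := ZE false; have [] := ZE true; rewrite -/(f true) -/(f false) /Lam /t /=.
rewrite (mulrC (q true) (q false)) (mulrC (Z true) (Z false)).
set w := Z false * Z true => _ qt Zf qf.
set F := q false in qf Zf *; set G := q true in qt Zf *.
(* The factors [Z] combine exactly so that the equation of [b], evaluated at [z w], has argument
   [z F G], the one at which [hat alpha] already occurs. *)
have FG : w * (f false @z w * (f true @z w)) = F * G.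
  by rewrite qf qt /w; ring.
have fw : f false @z w = fpsC (phi A p) + fpsX * (F * G * (r @z (F * G))).
  rewrite {1}fE compD compC compXM !compM compA compM FG.
  by rewrite -FG; ring.
rewrite compD.
have : F * (1 - fpsX * (hat alpha @z (F * G) * G)) = f false @z w.
  by rewrite {1}qf -mulrA Zf mulr1.
rewrite fw => FE; rewrite -[LHS](subrK (fpsX * (hat alpha @z (F * G) * G) * F)).
have -> : F - fpsX * (hat alpha @z (F * G) * G) * F =
  F * (1 - fpsX * (hat alpha @z (F * G) * G)) by ring.
by rewrite FE; ring.
Qed.

End Compression.

(** * From series to compressed distributions *)

Section Distributions.
Variables (C : numClosedFieldType) (A : ncps C) (p : A).
Hypotheses (tr : tracial A) (pp : p * p = p) (p0 : phi A p != 0).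
Let c := phi A p.

Definition rect_cumulants (r : fps C) : nat -> C :=
  fun k => coef (r @z fpsC c) k.-1.

Lemma rect_cumulantsD r r' :
  rect_cumulants (r + r') =+ (fun k => rect_cumulants r k + rect_cumulants r' k).
Proof. by move=> k _; rewrite /rect_cumulants compD fcoefD. Qed.

Lemma compressed_deconv v (r : fps C) :
    let F i := alt_series p v i in
    F false = fpsC c + fpsX * (F false * F true * (r @z (F false * F true))) ->
  compressed_distr p v [/] marchenko_pastur c =+
    moments_of_cumulants (rect_cumulants r).
Proof.
move=> F FE; apply/(deconvP p0).
apply: (@compressed_moments _ _ p0 _ r (F false) (F true)) => //.
- by move=> [//|k] _; apply: alt_series_compressed.
- exact: alt_series_true.
Qed.

(** The product of the two series has constant term [phi(p)], which is nonzero, so [z] times it can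
    be inverted under composition. Hence [b] may be arbitrary. *)
Lemma alt_series_rect v : exists r : fps C,
  let F i := alt_series p v i in
  F false = fpsC c + fpsX * (F false * F true * (r @z (F false * F true))).
Proof.
pose F i := alt_series p v i.
have u0 : coef (F false * F true) 0 != 0 by rewrite fcoefM0 /= phi1 mulr1.
have [z zE] := fps_inverse u0.
have [r rE] := comp_surj (z * shift (F false)) u0.
exists r; rewrite /= -/(F false) -/(F true) rE (mulrA (F false * F true)) zE mul1r.
exact: (shiftE (F false)).
Qed.

Lemma alt_series0 : alt_series p 0 false = fpsC c.
Proof.
apply: fpsP => -[//|k]; rewrite [LHS]/= mulr0 !mul0r.
exact: linear0.
Qed.

End Distributions.

Lemma rdiag_compressed_sum (C : numClosedFieldType) (A : ncps C) (a p b : A) :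
    tracial A -> star_free [set a] [set p; b] -> R_diagonal a -> projection p ->
    phi A p != 0 ->
  let deconv v := compressed_distr p v [/] marchenko_pastur (phi A p) in
  exists ra rb : fps C,
    [/\ deconv a =+ moments_of_cumulants (rect_cumulants p ra),
        deconv b =+ moments_of_cumulants (rect_cumulants p rb) &
        deconv (a + b) =+ moments_of_cumulants (rect_cumulants p (ra + rb))].
Proof.
move=> tr fr [alpha aE] [pp _] p0 deconv.
have [D1 DD DZ _ _] := star_alg_genP [set p; b].
have pD : star_alg_gen [set p; b] p by apply: sub_star_alg_gen; left.
have bD : star_alg_gen [set p; b] b by apply: sub_star_alg_gen; right.
have zD : star_alg_gen [set p; b] 0 by rewrite -(scale0r (1 : A)); apply: DZ.
have [r rE] := alt_series_rect p0 b.
exists (hat alpha), r; split; apply: compressed_deconv => //.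
  (* The case [b = 0], [r = 0] identifies the series of [a] as [hat alpha]. *)
  have := @alt_series_sum _ _ a 0 p _ alpha fr aE pD zD tr pp 0.
  rewrite !addr0 /=; apply; rewrite (alt_series0 p).
  by rewrite -fpsC0 compC fpsC0 !mulr0 addr0.
exact: (@alt_series_sum _ _ a b p _ alpha fr aE pD bD tr pp r).
Qed.

(** The equation fixes the deconvolution of [mu], and [deconvP] recovers [mu] from it. A second
    triple with the same [c] and the same two compressed distributions satisfies the same equation,
    which expresses independence from mixed moments. *)
Lemma compressed_sum_deconv (C : numClosedFieldType) (c : C) (c_neq0 : c != 0)
    (A : ncps C) (a p b : A)
    (phi_tracial : tracial A)
    (a_pb_free : star_free [set a] [set p; b])
    (a_Rdiag : R_diagonal a)
    (p_proj : projection p)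
    (phi_p : phi A p = c) :
  let equation (mu mu_a mu_b : nat -> C) : Prop :=
    mu [/] marchenko_pastur c =+
      (mu_a [/] marchenko_pastur c) [+] (mu_b [/] marchenko_pastur c) in
  [/\ equation (compressed_distr p (a + b))
               (compressed_distr p a) (compressed_distr p b),
      forall mu : nat -> C,
        equation mu (compressed_distr p a) (compressed_distr p b) ->
        mu =+ compressed_distr p (a + b) &
      forall (A' : ncps C) (a' p' b' : A'),
        tracial A' ->
        star_free [set a'] [set p'; b'] ->
        R_diagonal a' ->
        projection p' ->
        phi A' p' = c ->
        compressed_distr p' a' =+ compressed_distr p a ->
        compressed_distr p' b' =+ compressed_distr p b ->
        compressed_distr p' (a' + b') =+ compressed_distr p (a + b)].
Proof.
move=> equation.
have equationP (A1 : ncps C) (a1 p1 b1 : A1) : tracial A1 ->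
    star_free [set a1] [set p1; b1] -> R_diagonal a1 -> projection p1 ->
    phi A1 p1 = c ->
  equation (compressed_distr p1 (a1 + b1)) (compressed_distr p1 a1)
           (compressed_distr p1 b1).
  move=> tr1 fr1 rd1 pr1 phi1; have p10 : phi A1 p1 != 0 by rewrite phi1.
  have := rdiag_compressed_sum tr1 fr1 rd1 pr1 p10.
  rewrite phi1 => -[ra [rb [aE bE abE]]].
  apply: eq_pos_trans abE _.
  rewrite /free_add (free_cumulants_ext aE) (free_cumulants_ext bE).
  rewrite (@moments_ext _ (rect_cumulants p1 (ra + rb)) (fun k =>
    free_cumulants (moments_of_cumulants (rect_cumulants p1 ra)) k +
    free_cumulants (moments_of_cumulants (rect_cumulants p1 rb)) k)) // => k k0.
  by rewrite !free_cumulants_moments // rect_cumulantsD.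
have unique mu : equation mu (compressed_distr p a) (compressed_distr p b) ->
    mu =+ compressed_distr p (a + b).
  rewrite /equation /free_add => muE.
  have abE := equationP _ _ _ _ phi_tracial a_pb_free a_Rdiag p_proj phi_p.
  apply: eq_pos_trans (iffLR (deconvP c_neq0 _ _) muE) _.
  exact/eq_pos_sym/(iffLR (deconvP c_neq0 _ _) abE).
split=> [||A' a' p' b' tr' fr' rd' pr' phi' aE bE]; [exact: equationP|exact: unique|].
apply: unique; have := equationP _ _ _ _ tr' fr' rd' pr' phi'.
by rewrite /equation /free_mul_deconv (free_cumulants_ext aE) (free_cumulants_ext bE).
Qed.

Theorem theorem3p4 (R : realType) (c : R[i]) (c_neq0 : c != 0)
    (A : ncps R[i]) (a p b : A)
    (phi_tracial : tracial A)
    (a_pb_free : star_free [set a] [set p; b])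
    (a_Rdiag : R_diagonal a)
    (p_proj : projection p)
    (phi_p : phi A p = c) :
  let equation (mu mu_a mu_b : nat -> R[i]) : Prop :=
    mu [/] marchenko_pastur c =+
      (mu_a [/] marchenko_pastur c) [+] (mu_b [/] marchenko_pastur c) in
  [/\ equation (compressed_distr p (a + b))
               (compressed_distr p a) (compressed_distr p b),
      forall mu : nat -> R[i],
        equation mu (compressed_distr p a) (compressed_distr p b) ->
        mu =+ compressed_distr p (a + b) &
      forall (A' : ncps R[i]) (a' p' b' : A'),
        tracial A' ->
        star_free [set a'] [set p'; b'] ->
        R_diagonal a' ->
        projection p' ->
        phi A' p' = c ->
        compressed_distr p' a' =+ compressed_distr p a ->
        compressed_distr p' b' =+ compressed_distr p b ->
        compressed_distr p' (a' + b') =+ compressed_distr p (a + b)].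
Proof.
exact: (compressed_sum_deconv c_neq0 phi_tracial a_pb_free a_Rdiag p_proj phi_p).
Qed.
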